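(* Let $K$ be a field, $S=K[x_1,\ldots,x_6]$, and let $(0)\neq I\subset S$ be a proper squarefree monomial ideal. Then $\operatorname{hdepth}(I)\geq \operatorname{hdepth}(S/I)$.
   Context: $S=K[x_1,\ldots,x_6]$ is the polynomial ring over a field $K$ with its standard grading. For a nonzero finitely generated graded $S$-module $M$, the Hilbert depth $\operatorname{hdepth}(M)$ is the maximal depth of a finitely generated graded $S$-module $N$ having the same Hilbert series as $M$. *)

(* Defs.v *)
From HB Require Import structures.
From mathcomp Require Import all_boot all_order all_algebra.
From mathcomp Require Import boolp classical_sets.
From mathcomp Require Import mpoly.

Set Implicit Arguments.
Unset Strict Implicit.
Unset Printing Implicit Defensive.

Import GRing.Theory.
Local Open Scope ring_scope.

(* The largest element of a set of natural numbers; junk value 0 when the set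
   has no largest element. *)
Definition max_nat (A : set nat) : nat :=
  xget 0%N [set d | A d /\ forall k, A k -> (k <= d)%N]%classic.

(* A Z-grading C of a module over K[x_0, ..., x_(n-1)], the latter being graded
   by total degree.  The case e = 0 of [gradZ] says that every C d is stable
   under scaling by K. *)
Record is_grading (K : fieldType) (n : nat) (M : lmodType {mpoly K[n]})
    (C : int -> set M) : Prop := IsGrading {
  grad0 : forall d, C d 0;
  gradD : forall d u v, C d u -> C d v -> C d (u + v);
  gradZ : forall (e : nat) d (p : {mpoly K[n]}) v,
    p \is e.-homog -> C d v -> C (e%:Z + d) (p *: v);
  grad_span : forall v, exists (s : seq int) (f : int -> M),
    (forall d, C d (f d)) /\ v = \sum_(d <- s) f d;
  grad_free : forall (s : seq int) (f : int -> M),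
    uniq s -> (forall d, C d (f d)) -> \sum_(d <- s) f d = 0 ->
    forall d, d \in s -> f d = 0
}.

Structure graded_module (K : fieldType) (n : nat) := GradedModule {
  gmod_sort :> lmodType {mpoly K[n]};
  hcomp : int -> set gmod_sort;
  hcomp_grading : is_grading hcomp
}.
Arguments hcomp {K n} M d : rename.

Definition finitely_generated (K : fieldType) (n : nat)
    (M : lmodType {mpoly K[n]}) : Prop :=
  exists (k : nat) (g : 'I_k -> M), forall v : M,
    exists c : 'I_k -> {mpoly K[n]}, v = \sum_(i < k) c i *: g i.

(* W is a K-subspace of M of dimension k: it has a basis of k elements. *)
Definition has_dim (K : fieldType) (n : nat) (M : lmodType {mpoly K[n]})
    (W : set M) (k : nat) : Prop :=
  exists b : 'I_k -> M, (forall i, W (b i)) /\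
    forall v, W v ->
      exists! c : {ffun 'I_k -> K}, v = \sum_(i < k) (c i)%:MP *: b i.

(* Equality of the Laurent series \sum_d (dim_K M_d) t^d, coefficientwise. *)
Definition same_hilbert_series (K : fieldType) (n : nat)
    (M N : graded_module K n) : Prop :=
  forall d : int, exists k : nat,
    has_dim (hcomp M d) k /\ has_dim (hcomp N d) k.

(* (s)M, for the ideal (s) generated by the elements of s *)
Definition ideal_mul (K : fieldType) (n : nat) (M : lmodType {mpoly K[n]})
    (s : seq {mpoly K[n]}) : set M :=
  [set v | exists w : 'I_(size s) -> M, v = \sum_(i < size s) s`_i *: w i]%classic.

(* s is an M-regular sequence contained in the ideal (x_0, ..., x_(n-1)). *)
Definition regular_sequence (K : fieldType) (n : nat)
    (M : lmodType {mpoly K[n]}) (s : seq {mpoly K[n]}) : Prop :=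
  [/\ forall f, f \in s -> f@_0%MM = 0,
      forall (i : nat) (v : M), (i < size s)%N ->
        ideal_mul (take i s) (s`_i *: v) -> ideal_mul (take i s) v
    & exists v : M, ~ ideal_mul s v].

Definition depth (K : fieldType) (n : nat) (M : lmodType {mpoly K[n]}) : nat :=
  max_nat [set r | exists s : seq {mpoly K[n]},
    size s = r /\ regular_sequence M s]%classic.

Definition hdepth (K : fieldType) (n : nat) (M : graded_module K n) : nat :=
  max_nat [set d | exists N : graded_module K n,
    [/\ finitely_generated N, same_hilbert_series M N & depth N = d]]%classic.

(* Every idealr is proper: it does not contain 1. *)
Definition squarefree_monomial_ideal (K : fieldType) (n : nat)
    (I : idealr {mpoly K[n]}) : Prop :=
  exists (k : nat) (g : 'I_k -> 'X_{1..n}),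
    (forall j i, (g j i <= 1)%N) /\
    forall p, p \in I <->
      exists c : 'I_k -> {mpoly K[n]}, p = \sum_(j < k) c j * 'X_[g j].

Definition homogeneous_ideal (K : fieldType) (n : nat)
    (I : idealr {mpoly K[n]}) : Prop :=
  forall (d : nat) p, p \in I -> pihomog mdeg d p \in I.

Lemma squarefree_monomial_homogeneous (K : fieldType) (n : nat)
    (I : idealr {mpoly K[n]}) :
  squarefree_monomial_ideal I -> homogeneous_ideal I.
Proof.
case=> k [g [_ HG]] d p pI.
have supp m : m \in msupp p -> 'X_[m] \in I.
  move=> mp; have [c pE] := (HG p).1 pI.
  have [j gm] : exists j, m \in msupp (c j * 'X_[g j]).
    apply: contrapT => H; move: mp; rewrite mcoeff_msupp => /eqP; apply.
    rewrite pE raddf_sum /= big1 // => j _.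
    by apply: memN_msupp_eq0; apply/negP => gm; apply: H; exists j.
  move: gm; rewrite (perm_mem (msuppMX _ _)) => /mapP[m' _ ->].
  rewrite addmC mpolyXD; apply: idealMr; apply/HG.
  exists (fun i => (i == j)%:R); rewrite (bigD1 j) //= eqxx mul1r.
  by rewrite big1 ?addr0 // => i /negPf ->; rewrite mul0r.
rewrite pihomogE big_seq_cond; apply: rpred_sum => m /andP[mp _].
by rewrite -mul_mpolyC; apply/idealMr/supp.
Qed.

(* The homogeneous polynomials of degree d, together with 0. *)
Definition hpoly (K : fieldType) (n : nat) (d : int) : set {mpoly K[n]} :=
  fun p => if d is Posz e then is_true (p \is e.-homog) else p = 0.
Arguments hpoly : clear implicits.

Definition hpart (K : fieldType) (n : nat) (d : int) (p : {mpoly K[n]}) :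
    {mpoly K[n]} := if d is Posz e then pihomog mdeg e p else 0.

Section Hpoly.
Variables (K : fieldType) (n : nat).
Implicit Types (p q : {mpoly K[n]}) (d : int) (s : seq int).

Lemma hpoly0 d : hpoly K n d 0.
Proof. by case: d => e //=; exact: dhomog0. Qed.

Lemma hpolyD d p q : hpoly K n d p -> hpoly K n d q -> hpoly K n d (p + q).
Proof. by case: d => e /=; [exact: rpredD | move=> -> ->; rewrite addr0]. Qed.

Lemma hpolyM (e : nat) d p q :
  p \is e.-homog -> hpoly K n d q -> hpoly K n (e%:Z + d) (p * q).
Proof.
case: d => f /= hp; first exact: dhomogM.
by move=> ->; rewrite mulr0; exact: hpoly0.
Qed.

Lemma hpartP d p : hpoly K n d (hpart d p).
Proof. by case: d => e //=; exact: pihomogP. Qed.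

Lemma hpart_sum p :
  p = \sum_(d <- [seq i%:Z | i <- iota 0 (msize p)]) hpart d p.
Proof.
rewrite big_map /= -[X in iota 0 X]subn0 big_mkord.
by apply: pihomog_partitionE.
Qed.

Lemma hpart_hpoly d d' p : hpoly K n d p -> hpart d' p = if d == d' then p else 0.
Proof.
case: eqP => [<-|/eqP neq].
  by case: d => e /=; [exact: pihomog_dE | move=> ->].
case: d d' neq => e [e'|e'] //= neq; last by move=> ->; rewrite pihomog0.
by apply: pihomog_ne0.
Qed.

Lemma hpartD d p q : hpart d (p + q) = hpart d p + hpart d q.
Proof. by case: d => e /=; rewrite ?pihomogD ?addr0. Qed.

Lemma hpart0 d : hpart d (0 : {mpoly K[n]}) = 0.
Proof. by case: d => e //=; rewrite pihomog0. Qed.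

Lemma hpart_sum_hpoly d s (f : int -> {mpoly K[n]}) :
  uniq s -> (forall e, hpoly K n e (f e)) -> d \in s ->
  hpart d (\sum_(e <- s) f e) = f d.
Proof.
move=> us hf ds.
have -> : hpart d (\sum_(e <- s) f e) = \sum_(e <- s) hpart d (f e).
  by apply: (big_morph _ (hpartD d) (hpart0 d)).
rewrite (bigD1_seq d) //= (hpart_hpoly _ (hf d)) eqxx big1 ?addr0 // => e ne.
by rewrite (hpart_hpoly _ (hf e)) (negPf ne).
Qed.

Lemma hpart_ideal (I : idealr {mpoly K[n]}) d p :
  homogeneous_ideal I -> p \in I -> hpart d p \in I.
Proof. by move=> hI pI; case: d => e /=; [exact: hI | exact: rpred0]. Qed.
End Hpoly.

(* An ideal I of S and the quotient S/I, as S-modules. *)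
Section IdealModules.
Variables (K : fieldType) (n : nat) (I : idealr {mpoly K[n]}).
Local Notation S := {mpoly K[n]}.

Record ideal_module := IdealModule { ideal_val :> S; _ : ideal_val \in I }.

HB.instance Definition _ := [isSub for ideal_val].
HB.instance Definition _ := [Choice of ideal_module by <:].
HB.instance Definition _ := [SubChoice_isSubZmodule of ideal_module by <:].

Lemma ideal_valP (v : ideal_module) : val v \in I.
Proof. by case: v. Qed.

Definition ideal_scale (p : S) (v : ideal_module) : ideal_module :=
  IdealModule (idealMr p (ideal_valP v)).

Lemma ideal_scaleA a b v :
  ideal_scale a (ideal_scale b v) = ideal_scale (a * b) v.
Proof. by apply: val_inj; rewrite /= mulrA. Qed.
Lemma ideal_scale1 : left_id 1 ideal_scale.
Proof. by move=> v; apply: val_inj; rewrite /= mul1r. Qed.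
Lemma ideal_scaleDr : right_distributive ideal_scale +%R.
Proof. by move=> a u v; apply: val_inj; rewrite /= mulrDr. Qed.
Lemma ideal_scaleDl v : {morph ideal_scale^~ v : a b / a + b}.
Proof. by move=> a b; apply: val_inj; rewrite /= mulrDl. Qed.
HB.instance Definition _ := GRing.Zmodule_isLmodule.Build S ideal_module
  ideal_scaleA ideal_scale1 ideal_scaleDr ideal_scaleDl.

Definition quotient_module := {ideal_quot I}.
HB.instance Definition _ := GRing.Zmodule.on quotient_module.

Definition quotient_proj (p : S) : quotient_module := \pi_{ideal_quot I}%qT p.

Definition quotient_scale (p : S) (x : quotient_module) : quotient_module :=
  (quotient_proj p : {ideal_quot I}) * (x : {ideal_quot I}).

Lemma quotient_scaleA a b v :
  quotient_scale a (quotient_scale b v) = quotient_scale (a * b) v.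
Proof. by rewrite /quotient_scale /quotient_proj rmorphM mulrA. Qed.
Lemma quotient_scale1 : left_id 1 quotient_scale.
Proof. by move=> v; rewrite /quotient_scale /quotient_proj rmorph1 mul1r. Qed.
Lemma quotient_scaleDr : right_distributive quotient_scale +%R.
Proof. by move=> a u v; exact: mulrDr. Qed.
Lemma quotient_scaleDl v : {morph quotient_scale^~ v : a b / a + b}.
Proof.
by move=> a b; rewrite /quotient_scale /quotient_proj rmorphD; exact: mulrDl.
Qed.
HB.instance Definition _ := GRing.Zmodule_isLmodule.Build S quotient_module
  quotient_scaleA quotient_scale1 quotient_scaleDr quotient_scaleDl.

Lemma quotient_projD a b :
  quotient_proj (a + b) = quotient_proj a + quotient_proj b.
Proof. by rewrite /quotient_proj rmorphD. Qed.
Lemma quotient_proj0 : quotient_proj 0 = 0.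
Proof. by rewrite /quotient_proj rmorph0. Qed.
Lemma quotient_projZ a b : quotient_proj (a * b) = a *: quotient_proj b.
Proof. by rewrite /quotient_proj rmorphM. Qed.
Lemma quotient_proj_sum (T : Type) (s : seq T) (f : T -> S) :
  quotient_proj (\sum_(i <- s) f i) = \sum_(i <- s) quotient_proj (f i).
Proof. by apply: (big_morph _ quotient_projD quotient_proj0). Qed.
Lemma quotient_proj_eq0 p : quotient_proj p = 0 <-> p \in I.
Proof.
rewrite -[p in p \in I]subr0 Quotient.idealrBE -quotient_proj0.
exact: rwP eqP.
Qed.

Definition ideal_hcomp (d : int) : set ideal_module :=
  fun v => hpoly K n d (val v).

Definition quotient_hcomp (d : int) : set quotient_module :=
  fun x => exists2 p, hpoly K n d p & x = quotient_proj p.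

Hypothesis hI : homogeneous_ideal I.

Lemma ideal_grading : is_grading ideal_hcomp.
Proof.
split=> [d|d u v|e d p v|v|s f us hf f0 d ds].
- exact: hpoly0.
- exact: hpolyD.
- exact: hpolyM.
- exists [seq i%:Z | i <- iota 0 (msize (val v))].
  exists (fun d => IdealModule (hpart_ideal d hI (ideal_valP v))).
  split=> [d|]; first exact: hpartP.
  by apply: val_inj; rewrite raddf_sum /=; exact: hpart_sum.
- apply: val_inj; rewrite raddf0 -(hpart_sum_hpoly us hf ds).
  by rewrite -(raddf_sum val) f0 raddf0 hpart0.
Qed.

Lemma quotient_grading : is_grading quotient_hcomp.
Proof.
split=> [d|d u v [p hp ->] [q hq ->]|e d p v hp [q hq ->]|v|s f us hf f0 d ds].
- by exists 0; [exact: hpoly0 | rewrite quotient_proj0].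
- by exists (p + q); [exact: hpolyD | rewrite quotient_projD].
- by exists (p * q); [exact: hpolyM | rewrite quotient_projZ].
- exists [seq i%:Z | i <- iota 0 (msize (repr v))].
  exists (fun d => quotient_proj (hpart d (repr v))).
  split=> [d|]; first by exists (hpart d (repr v)); [exact: hpartP|].
  by rewrite -quotient_proj_sum -hpart_sum /quotient_proj reprK.
- have [g hg fE] : exists2 g : int -> S,
      forall e, hpoly K n e (g e) & forall e, f e = quotient_proj (g e).
    have /choice[g hg] : forall e, exists p, hpoly K n e p /\ f e = quotient_proj p.
      by move=> e; have [p] := hf e; exists p.
    by exists g => e; have [] := hg e.
  rewrite fE; apply/quotient_proj_eq0; rewrite -(hpart_sum_hpoly us hg ds).
  apply: hpart_ideal => //; apply/quotient_proj_eq0.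
  by rewrite quotient_proj_sum -[RHS]f0; apply: eq_bigr => e _; rewrite fE.
Qed.

Definition ideal_gmod : graded_module K n := GradedModule ideal_grading.
Definition quotient_gmod : graded_module K n := GradedModule quotient_grading.

End IdealModules.

(* Main.v *)
Require Import Defs.
From HB Require Import structures.
From mathcomp Require Import all_boot all_order all_algebra.
From mathcomp Require Import boolp mpoly zify.
From mathcomp Require classical_sets.

Set Implicit Arguments.
Unset Strict Implicit.
Unset Printing Implicit Defensive.
Import Order.TTheory GRing.Theory Num.Theory.
Local Open Scope ring_scope.

(** The numerical side of the theorem is the criterion that d is at most the Hilbert
    depth of a module M exactly when (1 - t)^d H_M(t) has nonnegative coefficients.
    For I and S/I, with I squarefree, H_M is a sum of terms (t/(1 - t))^|A| over the
    squarefree monomials x_A in I, respectively outside I.  The condition then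
    concerns finitely many integers, the coefficients of [family_poly].

    Necessity ([regular_sequence_bdiff_ge0]).  Let N have a regular sequence of length
    r in the ideal of the variables; its members need not be homogeneous, and K may be
    finite, so that linear forms over K need not do.  Adjoin an indeterminate u and
    take the generic form g = x_0 + x_1 u + x_2 u^2 + ... .  By McCoy's theorem g is a
    nonzerodivisor as soon as no nonzero element of N is killed by all variables
    ([generic_form_nonzerodivisor]).  Applying this to N and its quotients by initial
    segments of the sequence, one may divide N[u] by g and keep a regular sequence of
    length r - 1 ([generic_form_regular]), while the Hilbert function, now a generic
    rank over K[u], is replaced by its first difference ([has_rank_quotient]).  After
    r steps, the r-th difference of the Hilbert function of N is itself a rank.  The
    module is kept as a graded quotient of a free module over a domain, so that
    adjoining u only changes coefficients.

    Sufficiency ([leq_hdepth_ideal]).  If the numerator of I is nonnegative, a direct sum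
    of modules K[x_0, ..., x_(r-1)](-a) with all r >= d has the Hilbert series of I,
    and x_0, ..., x_(d-1) is regular on it.  Necessity also bounds the depth of every
    module with the Hilbert series of I by the number of variables
    ([ideal_regular_leq]), so that all maxima involved exist.

    It remains to compare the numerators of S/I and I for 0 < d < 6.  Let f_j and g_j
    be the numbers of squarefree monomials of degree j outside I and in I, so that
    f_j + g_j is a binomial coefficient.  The sets A with x_A in I form an up-closed
    family, whose levels satisfy the local LYM inequality ([card_level_LYM]) and the
    Bonferroni-type lower bound on shadows ([card_level_bonferroni]).  Together with the
    nonnegativity for S/I these imply the nonnegativity for I
    ([complement_coef_ge0]). *)

(** * Linear dependence over an integral domain *)

(** Fraction-free Gaussian elimination: a pivot in the first column clears that
    column from the other rows, after scaling them, and the shortened rows are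
    dependent by induction. *)
Lemma linear_dependence (A : idomainType) (q p : nat) (B : 'I_p -> 'I_q -> A) :
  (q < p)%N ->
  exists2 c : 'I_p -> A, exists i, c i != 0 & forall j, \sum_i c i * B i j = 0.
Proof.
elim: q p B => [|q IHq] [|p] B // ltqp.
  by exists (fun=> 1) => [|[]//]; exists ord0; exact: oner_neq0.
have [/forallP B0|] := boolP [forall i, B i ord0 == 0].
  have [|c c0 cB] := IHq p.+1 (fun i j => B i (lift ord0 j)).
    exact: ltnW.
  exists c => // j; case: (unliftP ord0 j) => [j' ->|->]; first exact: cB.
  by rewrite big1 // => i _; rewrite (eqP (B0 i)) mulr0.
rewrite negb_forall => /existsP[i0 Bi0].
pose B' k j := B i0 ord0 * B (lift i0 k) (lift ord0 j)
               - B (lift i0 k) ord0 * B i0 (lift ord0 j).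
have [//|c [k ck] cB] := IHq p B'.
pose d i := if unlift i0 i is Some k then c k * B i0 ord0
            else - \sum_k c k * B (lift i0 k) ord0.
exists d => [|j].
  by exists (lift i0 k); rewrite /d liftK mulf_neq0.
rewrite (bigD1_ord i0) //= {1}/d unlift_none.
under eq_bigr do rewrite /d liftK.
case: (unliftP ord0 j) => [j' ->|->].
  rewrite mulNr mulr_suml -sumrN -big_split -[RHS](cB j') /=.
  by apply: eq_bigr => l _; rewrite mulrBr !mulrA addrC.
rewrite mulNr mulr_suml -sumrN -big_split /= big1 // => l _.
by rewrite mulrAC addNr.
Qed.

(** * Weakly regular sequences modulo a submodule of a free module *)

Section Regular.
Variables (S : comNzRingType) (k : nat).
Local Notation V := 'rV[S]_k.
Implicit Types (R : V -> Prop) (s : seq S) (v w : V).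

Record is_submodule R : Prop := IsSubmodule {
  submod0 : R 0;
  submodD : forall v w, R v -> R w -> R (v + w);
  submodZ : forall a v, R v -> R (a *: v)
}.

(** The module V/R is never formed: its quotient by f is recorded by the larger
    submodule R + f V, so that the carrier V stays a module of rows. *)
Definition add_multiples R f : V -> Prop := fun v => exists w, R (v - f *: w).

Fixpoint weakly_regular R s : Prop :=
  if s is f :: s' then
    (forall v, R (f *: v) -> R v) /\ weakly_regular (add_multiples R f) s'
  else True.

Lemma submodN R v : is_submodule R -> R v -> R (- v).
Proof. by move=> HR Rv; rewrite -scaleN1r; exact: submodZ. Qed.

Lemma submodB R v w : is_submodule R -> R v -> R w -> R (v - w).
Proof. by move=> HR Rv Rw; apply: submodD => //; exact: submodN. Qed.

Lemma submod_sum R (I : Type) (r : seq I) (P : pred I) (F : I -> V) :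
  is_submodule R -> (forall i, P i -> R (F i)) -> R (\sum_(i <- r | P i) F i).
Proof.
move=> HR HF; apply: big_ind => //; first exact: submod0.
by move=> *; exact: submodD.
Qed.

Lemma submodDl R v w : is_submodule R -> R w -> R (v + w) -> R v.
Proof. by move=> HR Rw Rvw; rewrite -[v](addrK w); exact: submodB. Qed.

Lemma add_multiples_submodule R f :
  is_submodule R -> is_submodule (add_multiples R f).
Proof.
move=> HR; split.
- by exists 0; rewrite scaler0 subr0; exact: submod0.
- move=> v w [v' Hv] [w' Hw]; exists (v' + w').
  by rewrite scalerDr opprD addrACA; exact: submodD.
- move=> a v [v' Hv]; exists (a *: v').
  by rewrite scalerA mulrC -scalerA -scalerBr; exact: submodZ.
Qed.

Lemma weakly_regular_ext R1 R2 s :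
  (forall v, R1 v <-> R2 v) -> weakly_regular R1 s -> weakly_regular R2 s.
Proof.
by move=> R12; have -> : R2 = R1 by apply/funext => v; apply/propext; split=> /R12.
Qed.

Definition in_ideal xs f := exists c : nat -> S, f = \sum_(i < size xs) c i * xs`_i.

(** A socle element modulo R is killed by the whole ideal.  Hence a nonzerodivisor
    lying in the ideal rules out socle elements, which is how the hypothesis of
    [generic_form_nonzerodivisor] is met. *)
Lemma in_ideal_killed R xs f v : is_submodule R -> in_ideal xs f ->
  (forall a, a \in xs -> R (a *: v)) -> R (f *: v).
Proof.
move=> HR [c ->] Hv; rewrite scaler_suml; apply: submod_sum => // i _.
by rewrite -scalerA; apply: submodZ => //; apply: Hv; exact: mem_nth.
Qed.

End Regular.

(** * The generic linear form *)

Section GenericForm.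
Variables (S : comNzRingType) (k : nat).
Local Notation V := 'rV[S]_k.
Local Notation VX := 'rV[{poly S}]_k.
Implicit Types (R : V -> Prop) (w : VX).

Definition coefv j w : V := map_mx (coefp j) w.

(** The submodule R[u] of V[u], for a new indeterminate u. *)
Definition poly_ext R : VX -> Prop := fun w => forall j, R (coefv j w).

(** The form x_0 + x_1 u + x_2 u^2 + ...; distinct powers of one indeterminate
    already make it generic enough, and its coefficients are the x_i. *)
Definition generic_form (xs : seq S) : {poly S} :=
  \sum_(i < size xs) xs`_i *: 'X^i.

Lemma coefv0 j : coefv j 0 = 0. Proof. by rewrite /coefv map_mx0. Qed.
Lemma coefvD j u w : coefv j (u + w) = coefv j u + coefv j w.
Proof. by rewrite /coefv map_mxD. Qed.
Lemma coefvB j u w : coefv j (u - w) = coefv j u - coefv j w.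
Proof. by rewrite /coefv map_mxB. Qed.
Lemma coefv_sum j (I : Type) (r : seq I) (P : pred I) (F : I -> VX) :
  coefv j (\sum_(i <- r | P i) F i) = \sum_(i <- r | P i) coefv j (F i).
Proof. exact: (big_morph _ (coefvD j) (coefv0 j)). Qed.

Lemma coefvZ j p w :
  coefv j (p *: w) = \sum_(i < j.+1) p`_i *: coefv (j - i) w.
Proof.
apply/rowP => l; rewrite !mxE summxE /= coefM.
by apply: eq_bigr => i _; rewrite !mxE.
Qed.

Lemma coefvC j a w : coefv j (a%:P *: w) = a *: coefv j w.
Proof. by apply/rowP => l; rewrite !mxE /= coefCM. Qed.

Lemma coefvXn j i w :
  coefv j ('X^i *: w) = if (j < i)%N then 0 else coefv (j - i) w.
Proof. by apply/rowP => l; rewrite !mxE /= coefXnM; case: ifP; rewrite !mxE. Qed.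

Lemma coefv_bound w : exists d, forall j, (d <= j)%N -> coefv j w = 0.
Proof.
exists (\max_i size (w 0%R i))%N => j dj; apply/rowP => i.
by rewrite !mxE /= nth_default // (leq_trans _ dj) // (leq_bigmax i).
Qed.

Lemma poly_ext_submodule R : is_submodule R -> is_submodule (poly_ext R).
Proof.
move=> HR; split.
- by move=> j; rewrite coefv0; exact: submod0.
- by move=> v w Hv Hw j; rewrite coefvD; exact: submodD.
- move=> p v Hv j; rewrite coefvZ; apply: submod_sum => // i _.
  exact: submodZ.
Qed.

(** Extending scalars to S[u] commutes with dividing by f: the coefficientwise
    witnesses are zero above the degree of w, so they assemble into a row of
    polynomials. *)
Lemma poly_ext_add_multiples R f w : is_submodule R ->
  poly_ext (add_multiples R f) w <-> add_multiples (poly_ext R) f%:P w.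
Proof.
move=> HR; split; last first.
  by case=> u Hu j; exists (coefv j u); rewrite -coefvC -coefvB; exact: Hu.
move=> /choice[u Hu]; have [d wd] := coefv_bound w.
exists (\row_i \poly_(j < d) u j 0 i) => j; rewrite coefvB coefvC.
have [jd|dj] := ltnP j d.
  rewrite [coefv j (\row_i _)](_ : _ = u j); first exact: Hu.
  by apply/rowP => i; rewrite !mxE /= coef_poly jd.
rewrite wd // [coefv j _](_ : _ = 0).
  by rewrite scaler0 subr0; exact: submod0.
by apply/rowP => i; rewrite !mxE /= coef_poly ltnNge dj.
Qed.

Lemma generic_form_rcons xs a :
  generic_form (rcons xs a) = generic_form xs + a *: 'X^(size xs).
Proof.
rewrite /generic_form size_rcons big_ord_recr /= nth_rcons ltnn eqxx.
by congr (_ + _); apply: eq_bigr => i _; rewrite nth_rcons ltn_ord.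
Qed.

Lemma coefv_monomial j a i w :
  coefv j ((a *: 'X^i) *: w) = if (j < i)%N then 0 else a *: coefv (j - i) w.
Proof.
by rewrite -mul_polyC -scalerA coefvC coefvXn; case: ifP; rewrite ?scaler0.
Qed.

(** McCoy's theorem for modules.  The induction is on a bound d for the degree of w
    modulo R[u].  The top coefficient of the product shows that the last x_i kills
    the top coefficient of w, so that x_i w has smaller degree and vanishes by
    induction; dropping this x_i from the form, the same argument applies to the
    previous one.  Once every x_i kills w, the hypothesis on socle elements applies
    to each coefficient. *)
Lemma generic_form_nonzerodivisor R xs w : is_submodule R ->
  (forall v, (forall a, a \in xs -> R (a *: v)) -> R v) ->
  poly_ext R (generic_form xs *: w) -> poly_ext R w.
Proof.
move=> HR Rsoc; have HX := poly_ext_submodule HR.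
have [d wd] := coefv_bound w.
have {wd}: forall j, (d <= j)%N -> R (coefv j w).
  by move=> j dj; rewrite wd //; exact: submod0.
elim: d w => [|d IHd] w wd gw; first by move=> j; exact: wd.
(* The form is shortened to any ys whose form still kills w, while the induction
   hypothesis on d keeps using the full form xs. *)
suff kill ys : poly_ext R (generic_form ys *: w) ->
    forall a, a \in ys -> poly_ext R (a%:P *: w).
  move=> j; apply: Rsoc => a xa; rewrite -coefvC.
  exact: (kill xs).
elim/last_ind: ys => [|ys a IHys] // Hw.
have Ha : poly_ext R (a%:P *: w).
  apply: IHd => [j|]; last first.
    by rewrite scalerA mulrC -scalerA; exact: (submodZ HX).
  rewrite leq_eqVlt => /predU1P[<-|dj]; last first.
    by rewrite coefvC; apply: submodZ => //; exact: wd.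
  have := Hw (d + size ys)%N.
  rewrite generic_form_rcons scalerDl coefvD coefv_monomial ltnNge leq_addl /=.
  rewrite addnK coefvC addrC; apply: submodDl => //.
  rewrite /generic_form scaler_suml coefv_sum; apply: submod_sum => // i _.
  rewrite coefv_monomial; case: ifP => _; first exact: submod0.
  apply: submodZ => //; apply: wd; rewrite -addnBA ?(ltnW (ltn_ord i)) //.
  by rewrite -[X in (X < _)%N]addn0 ltn_add2l subn_gt0.
move=> b; rewrite mem_rcons inE => /predU1P[->//|]; apply: IHys.
move: Hw; rewrite generic_form_rcons scalerDl; apply: submodDl => //.
by rewrite -mul_polyC mulrC -scalerA; exact: (submodZ HX).
Qed.

(** If s_1, ..., s_r is weakly regular on P, then s_1, ..., s_(r-1) is weakly regular
    on P[u] / g P[u] for the generic form g.  Indeed g is a nonzerodivisor on each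
    P[u]/(s_1, ..., s_i) with i < r, because s_(i+1) excludes a socle there; and if
    f w = g u with g a nonzerodivisor modulo f, then u = f u', so that
    f (w - g u') = 0 and w lies in g P.  The s_i need not be homogeneous, whereas g
    is. *)
Lemma generic_form_regular R xs f s : is_submodule R ->
  {in f :: s, forall g, in_ideal xs g} -> weakly_regular R (f :: s) ->
  weakly_regular (add_multiples (poly_ext R) (generic_form xs))
                 [seq g%:P | g <- belast f s].
Proof.
elim: s f R => [//|f' s IHs] f R HR xs_s.
rewrite [weakly_regular R _]/= -/(weakly_regular _ (f' :: s)) => -[reg_f reg_s].
have HRf := add_multiples_submodule f HR.
have HX := poly_ext_submodule HR.
have xs_s' : {in f' :: s, forall g, in_ideal xs g}.
  by move=> g sg; apply: xs_s; rewrite inE sg orbT.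
split=> [w [u]|]; last first.
  apply: weakly_regular_ext (IHs f' _ HRf xs_s' reg_s) => w; split.
    move=> [u /(poly_ext_add_multiples _ _ HR)[v Hv]].
    by exists v, u; rewrite addrAC.
  move=> [v [u Hv]]; exists u; apply/poly_ext_add_multiples => //.
  by exists v; rewrite addrAC.
move=> Hu; have : poly_ext (add_multiples R f) u.
  apply: (@generic_form_nonzerodivisor _ xs) => // [v Hv|].
    have [reg_f' _] := reg_s; apply: reg_f'.
    by apply: in_ideal_killed Hv => //; apply: xs_s'; rewrite mem_head.
  apply/poly_ext_add_multiples => //; exists w.
  by rewrite -opprB; exact: (submodN HX).
case/poly_ext_add_multiples => // u' Hu'; exists u' => j; apply: reg_f.
rewrite -coefvC scalerBr.
have -> : f%:P *: w - f%:P *: (generic_form xs *: u') =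
   (f%:P *: w - generic_form xs *: u) + generic_form xs *: (u - f%:P *: u').
  by rewrite scalerBr addrA subrK !scalerA mulrC.
by rewrite coefvD; apply: (submodD HR); [exact: Hu | exact: (submodZ HX _ Hu')].
Qed.

End GenericForm.

Lemma linear_dependence_fin (A : idomainType) (Q P : finType) (B : P -> Q -> A) :
  (#|Q| < #|P|)%N ->
  exists2 c : P -> A, exists i, c i != 0 & forall j, \sum_i c i * B i j = 0.
Proof.
move=> /(linear_dependence (fun i j => B (enum_val i) (enum_val j)))[c [i ci] cB].
exists (c \o enum_rank) => [|j]; first by exists (enum_val i); rewrite /= enum_valK.
rewrite (reindex_onto enum_val enum_rank) /= => [|? _]; last exact: enum_rankK.
rewrite -[RHS](cB (enum_rank j)); apply: eq_big => l; first by rewrite enum_valK eqxx.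
by rewrite enum_valK enum_rankK.
Qed.

(** * Generic rank of a quotient *)

Section Rank.
Variables (A : idomainType) (S : comNzRingType) (phi : {rmorphism A -> S}) (k : nat).
Local Notation V := 'rV[S]_k.
Implicit Types (R H : V -> Prop) (T U : finType).

Definition independent R T (b : T -> V) :=
  forall c : T -> A, R (\sum_t phi (c t) *: b t) -> forall t, c t = 0.

(** Membership in the span after multiplication by a nonzero scalar; over the
    fraction field of A this is membership in the span.  Working over domains
    A, A[u], A[u][u'], ... avoids passing to fraction fields of rational
    functions. *)
Definition generically_spanned R T (b : T -> V) v :=
  exists (a : A) (c : T -> A), a != 0 /\ R (phi a *: v - \sum_t phi (c t) *: b t).

(** The rank of the image of H in V/R, in terms of a maximal independent family. *)
Definition has_rank R H h := exists (T : finType) (b : T -> V),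
  [/\ #|T| = h, forall t, H (b t), independent R b
    & forall v, H v -> generically_spanned R b v].

Lemma spanned_dependent R T U (b : T -> V) (u : U -> V) :
  is_submodule R -> (#|T| < #|U|)%N ->
  (forall i, generically_spanned R b (u i)) -> ~ independent R u.
Proof.
move=> HR ltTU /choice[a /choice[B HB]] Hu.
have [c [i ci] cB] := linear_dependence_fin B ltTU.
suff /Hu/(_ i)/eqP : R (\sum_i phi (c i * a i) *: u i).
  by rewrite mulf_eq0 (negPf ci) /=; apply/negP; have [] := HB i.
have -> : \sum_i phi (c i * a i) *: u i =
    \sum_i phi (c i) *: (phi (a i) *: u i - \sum_t phi (B i t) *: b t).
  rewrite [RHS](eq_bigr _ (fun i _ => scalerBr _ _ _)) sumrB.
  rewrite [X in _ - X](_ : _ = 0).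
    by rewrite subr0; apply: eq_bigr => l _; rewrite scalerA rmorphM.
  under eq_bigr do rewrite scaler_sumr.
  rewrite exchange_big /= big1 // => t _.
  under eq_bigr do rewrite scalerA -rmorphM.
  by rewrite -scaler_suml -rmorph_sum cB rmorph0 scale0r.
by apply: submod_sum => // l _; apply: submodZ => //; have [] := HB l.
Qed.

Definition extend_family T (b : T -> V) v (o : option T) := oapp b v o.

Lemma big_option T (F : option T -> V) : \sum_o F o = F None + \sum_t F (Some t).
Proof.
rewrite (bigD1 None) //=; congr (_ + _).
rewrite (reindex_omap Some id) /=; last by case.
by apply: eq_bigl => t; rewrite eqxx.
Qed.

Lemma independent_extend R T (b : T -> V) v : is_submodule R ->
  independent R b -> ~ generically_spanned R b v ->
  independent R (extend_family b v).
Proof.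
move=> HR Hb Hv c; rewrite big_option /= => Hc.
have [c0|c0] := eqVneq (c None) 0.
  case=> [t|//]; apply: (Hb (c \o Some)).
  by move: Hc; rewrite c0 rmorph0 scale0r add0r.
case: Hv; exists (c None), (fun t => - c (Some t)); split=> //.
rewrite -sumrN; under eq_bigr do rewrite rmorphN scaleNr opprK.
exact: Hc.
Qed.

Lemma has_rank_ge R H h T (b : T -> V) : is_submodule R -> has_rank R H h ->
  (forall t, H (b t)) -> independent R b -> (#|T| <= h)%N.
Proof.
move=> HR [U [u [<- _ _ spu]]] Hb indb; rewrite leqNgt; apply/negP => ltUT.
by apply: (spanned_dependent HR ltUT _ indb) => t; exact: spu.
Qed.

Lemma has_rank_lt R H h T (b : T -> V) : is_submodule R -> has_rank R H h ->
  (#|T| < h)%N -> exists2 v, H v & ~ generically_spanned R b v.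
Proof.
move=> HR [U [u [<- Hu indu _]]] ltTU; apply: contrapT => nex.
apply: (spanned_dependent (b := b) HR ltTU _ indu) => i.
by apply: contrapT => ni; apply: nex; exists (u i).
Qed.

Lemma has_rank_full R H h T (b : T -> V) v : is_submodule R -> has_rank R H h ->
  (forall t, H (b t)) -> independent R b -> #|T| = h -> H v ->
  generically_spanned R b v.
Proof.
move=> HR Hrk Hb indb cT Hv; apply: contrapT => nv.
have := has_rank_ge (b := extend_family b v) HR Hrk.
rewrite card_option cT ltnn => ge; have //: false.
by apply: ge; [case | exact: independent_extend].
Qed.

Definition is_subspace H := [/\ H 0, forall v w, H v -> H w -> H (v + w)
  & forall a v, H v -> H (phi a *: v)].

Lemma subspace_sum H T (c : T -> A) (b : T -> V) : is_subspace H ->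
  (forall t, H (b t)) -> H (\sum_t phi (c t) *: b t).
Proof. by move=> [H0 HD HZ] Hb; apply: big_ind => // t _; exact: HZ. Qed.

(** Additivity of the rank in 0 -> H1 -> H2 -> H2/gH1 -> 0.  A basis of H1 is carried
    by g to an independent family of H2, which extends to a maximal one; the added
    members form a basis of the quotient. *)
Lemma has_rank_quotient R H1 H2 (g : S) h1 h2 : is_submodule R ->
  is_subspace H2 ->
  (forall v, R (g *: v) -> R v) ->
  (forall v, H1 v -> H2 (g *: v)) ->
  (forall v, H2 v -> add_multiples R g v -> exists2 w, H1 w & R (v - g *: w)) ->
  has_rank R H1 h1 -> has_rank R H2 h2 ->
  (h1 <= h2)%N /\ has_rank (add_multiples R g) H2 (h2 - h1).
Proof.
move=> HR HH2 reg_g H12 Hg Hrk1 Hrk2; have [T [b [cT Hb indb spb]]] := Hrk1.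
have indgb : independent R (fun t => g *: b t).
  move=> c Hc; apply: indb; apply: reg_g; rewrite scaler_sumr.
  by move: Hc; under eq_bigr do rewrite scalerA mulrC -scalerA.
have le12 : (h1 <= h2)%N.
  by rewrite -cT; apply: has_rank_ge Hrk2 _ indgb => // t; exact: H12.
split=> //.
pose join U (u : U -> V) (s : T + U) :=
  match s with inl t => g *: b t | inr i => u i end.
have [U [u [cU Hu indu]]] : exists U (u : U -> V),
    [/\ #|U| = (h2 - h1)%N, forall i, H2 (u i) & independent R (join U u)].
  (* The family is enlarged one member at a time until it has h2 members. *)
  elim: {-2}(h2 - h1)%N (leqnn (h2 - h1)) => [|m IHm] ltm.
    exists void, (fun x : void => match x with end); split=> [|[]|c].
      by rewrite card_void.
    rewrite big_sumType /= [X in _ + X]big1 ?addr0; last by case.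
    by move=> Hc [t|[]]; exact: (indgb (c \o inl)).
  have [U [u [cU Hu indu]]] := IHm (ltnW ltm).
  have [|v Hv nspan] := has_rank_lt (join U u) HR Hrk2.
    by rewrite card_sum cT cU -ltn_subRL.
  exists (option U), (extend_family u v); split=> [|[]//|c Hc].
    by rewrite card_option cU.
  pose c' (o : option (T + U)) := match o with
    | None => c (inr None) | Some (inl t) => c (inl t)
    | Some (inr i) => c (inr (Some i)) end.
  have /(_ c') ind := independent_extend HR indu nspan.
  have {}ind : forall o, c' o = 0.
    apply: ind; move: Hc; rewrite big_option !big_sumType /= big_option /=.
    by rewrite addrCA.
  by case=> [t|[i|]];
    [exact: (ind (Some (inl t))) | exact: (ind (Some (inr i))) | exact: (ind None)].
have HJ s : H2 (join U u s) by case: s => [t|i] /=; [exact: H12 | exact: Hu].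
exists U, u; split=> // [c Hc|v Hv].
  have [w Hw Rw] := Hg _ (subspace_sum c HH2 Hu) Hc.
  have [a [d [a0 Ra]]] := spb w Hw.
  pose e (s : T + U) := match s with inl t => - d t | inr i => a * c i end.
  have : R (\sum_s phi (e s) *: join U u s).
    rewrite big_sumType /=.
    have -> : \sum_t phi (- d t) *: (g *: b t) + \sum_i phi (a * c i) *: u i =
      phi a *: (\sum_i phi (c i) *: u i - g *: w)
      + g *: (phi a *: w - \sum_t phi (d t) *: b t).
      rewrite !scalerBr !scaler_sumr addrA !scalerA [g * _]mulrC subrK addrC.
      rewrite -sumrN; congr (_ + _); apply: eq_bigr => i _.
        by rewrite rmorphN scaleNr !scalerA [g * _]mulrC.
      by rewrite rmorphM scalerA.
    by apply: submodD => //; exact: submodZ.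
  move=> /indu/(_ (inr _)) /= H i; apply/eqP.
  by have /eqP := H i; rewrite mulf_eq0 (negPf a0).
(* A family of h2 members is maximal, hence spans H2 generically modulo R. *)
have [|a [c [a0 Rv]]] := has_rank_full HR Hrk2 HJ indu _ Hv.
  by rewrite card_sum cT cU subnKC.
exists a, (c \o inr); split=> //; exists (\sum_t phi (c (inl t)) *: b t).
have -> : g *: (\sum_t phi (c (inl t)) *: b t) = \sum_t phi (c (inl t)) *: (g *: b t).
  by rewrite scaler_sumr; apply: eq_bigr => t _; rewrite !scalerA mulrC.
by move: Rv; rewrite big_sumType /= opprD addrA addrAC.
Qed.
End Rank.

(** * Gradings, and the drop of the Hilbert function *)

(** A grading of S given by its projections, with scalars A in degree 0 and the
    elements of xs in degree 1. *)
Record is_ring_grading (A : idomainType) (S : comNzRingType)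
    (phi : {rmorphism A -> S}) (xs : seq S) (pr : int -> {additive S -> S}) := {
  pr_scalar : forall e a f, pr e (phi a * f) = phi a * pr e f;
  pr_gen : forall e x f, x \in xs -> pr (e + 1) (x * f) = x * pr e f;
  pr_idem : forall e f, pr e (pr e f) = pr e f
}.

Section GradedRows.
Variables (S : comNzRingType) (pr : int -> {additive S -> S}).
Variables (k : nat) (a : 'I_k -> int).
Implicit Types (e : int) (v w : 'rV[S]_k).

(** The projection onto degree e of the free module with generators in degrees a i. *)
Definition hom_part e v : 'rV[S]_k := \row_i pr (e - a i) (v 0 i).

Definition is_hom e v := hom_part e v = v.

Lemma hom_partD e : {morph hom_part e : v w / v + w}.
Proof. by move=> v w; apply/rowP => i; rewrite !mxE raddfD. Qed.

Lemma hom_partN e : {morph hom_part e : v / - v}.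
Proof. by move=> v; apply/rowP => i; rewrite !mxE raddfN. Qed.

Lemma hom_part0 e : hom_part e 0 = 0.
Proof. by apply/rowP => i; rewrite !mxE raddf0. Qed.

Lemma hom_part_mul (g : S) e v :
  (forall e f, pr (e + 1) (g * f) = g * pr e f) ->
  hom_part e (g *: v) = g *: hom_part (e - 1) v.
Proof.
by move=> Hg; apply/rowP => i; rewrite !mxE -Hg; congr (pr _ _); rewrite addrAC subrK.
Qed.

Variables (A : idomainType) (phi : {rmorphism A -> S}) (xs : seq S).
Hypothesis Hpr : is_ring_grading phi xs pr.

Lemma hom_partZ e c v : hom_part e (phi c *: v) = phi c *: hom_part e v.
Proof. by apply/rowP => i; rewrite !mxE (pr_scalar Hpr). Qed.

Lemma hom_part_idem e v : is_hom e (hom_part e v).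
Proof. by apply/rowP => i; rewrite !mxE (pr_idem Hpr). Qed.

Lemma is_hom_subspace e : is_subspace phi (is_hom e).
Proof.
split=> [|v w Hv Hw|c v Hv]; rewrite /is_hom; first exact: hom_part0.
  by rewrite hom_partD Hv Hw.
by rewrite hom_partZ Hv.
Qed.

End GradedRows.

Definition poly_pr (S : comNzRingType) (pr : int -> {additive S -> S}) :
  int -> {additive {poly S} -> {poly S}} := fun e => map_poly (pr e).

Section PolyExtension.
Variables (A : idomainType) (S : comNzRingType) (phi : {rmorphism A -> S}).
Variables (xs : seq S) (pr : int -> {additive S -> S}).
Hypothesis Hpr : is_ring_grading phi xs pr.

Lemma poly_ring_grading :
  is_ring_grading (map_poly phi) [seq x%:P | x <- xs] (poly_pr pr).
Proof.
split=> [e p f|e _ f /mapP[x xs_x ->]|e f]; apply/polyP => j.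
- rewrite coef_map /= !coefM raddf_sum; apply: eq_bigr => i _.
  by rewrite !coef_map /= (pr_scalar Hpr).
- by rewrite coef_map /= !coefCM coef_map (pr_gen Hpr).
- by rewrite !coef_map /= (pr_idem Hpr).
Qed.

Lemma generic_form_degree e f :
  poly_pr pr (e + 1) (generic_form xs * f) = generic_form xs * poly_pr pr e f.
Proof.
rewrite /generic_form !mulr_suml raddf_sum; apply: eq_bigr => i _.
rewrite -mul_polyC -mulrA (pr_gen poly_ring_grading); last first.
  by apply: map_f; exact: mem_nth.
rewrite -mulrA; congr (_ * _).
by have := pr_scalar poly_ring_grading e 'X^i f; rewrite /= map_polyXn.
Qed.

Variables (k : nat) (a : 'I_k -> int).

Lemma coefv_hom_part e w j :
  coefv j (hom_part (poly_pr pr) a e w) = hom_part pr a e (coefv j w).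
Proof. by apply/rowP => i; rewrite !mxE /= coef_map. Qed.

Lemma coefv_const j p (v : 'rV[S]_k) : coefv j (p *: map_mx polyC v) = p`_j *: v.
Proof. by apply/rowP => i; rewrite !mxE /= coefMC. Qed.

Lemma coefv_inj (v w : 'rV[{poly S}]_k) : (forall j, coefv j v = coefv j w) -> v = w.
Proof.
move=> vw; apply/rowP => i; apply/polyP => j.
by have /rowP/(_ i) := vw j; rewrite !mxE.
Qed.

(** Ranks do not change under A -> A[u].  For a polynomial vector w, a common
    denominator of its coefficients is the product of their denominators. *)
Lemma has_rank_poly_ext R e h : is_submodule R ->
  has_rank phi R (is_hom pr a e) h ->
  has_rank (map_poly phi) (poly_ext R) (is_hom (poly_pr pr) a e) h.
Proof.
move=> HR [T [b [cT Hb indb spb]]]; exists T, (fun t => map_mx polyC (b t)).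
split=> // [t|c Hc t|w Hw].
- apply: coefv_inj => j; rewrite coefv_hom_part.
  rewrite -[map_mx _ _]scale1r coefv_const coef1.
  by case: (j == 0%N); rewrite ?scale1r ?scale0r ?hom_part0 ?Hb.
- apply/polyP => j; rewrite coef0.
  apply: (indb (fun t => (c t)`_j)); have := Hc j; rewrite coefv_sum.
  by under eq_bigr do rewrite coefv_const /= coef_map.
have /choice[d /choice[c Hdc]] j : exists (d : A) (c : T -> A),
    d != 0 /\ R (phi d *: coefv j w - \sum_t phi (c t) *: b t).
  by apply: spb; rewrite /is_hom -coefv_hom_part Hw.
have [n wn] := coefv_bound w.
exists (\prod_(i < n) d i)%:P.
exists (fun t => \poly_(j < n) ((\prod_(i < n | i != j :> nat) d i) * c j t)).
split=> [|j].
  by rewrite polyC_eq0; apply/prodf_neq0 => i _; have [] := Hdc i.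
rewrite coefvB coefv_sum.
under [X in _ - X]eq_bigr do rewrite coefv_const /= coef_map coef_poly.
rewrite /= map_polyC coefvC.
have [jn|nj] := ltnP j n; last first.
  rewrite wn // scaler0 big1 ?subr0 => [|t _]; first exact: submod0.
  by rewrite raddf0 scale0r.
rewrite (bigD1 (Ordinal jn)) //= rmorphM mulrC -scalerA.
rewrite (_ : \sum_t _ =
    phi (\prod_(i < n | i != j :> nat) d i) *: \sum_t phi (c j t) *: b t); last first.
  by rewrite scaler_sumr; apply: eq_bigr => t _; rewrite rmorphM scalerA.
by rewrite -scalerBr; apply: submodZ => //; have [] := Hdc j.
Qed.

End PolyExtension.

Definition bdiff (f : int -> int) : int -> int := fun e => f e - f (e - 1).


Lemma in_ideal_poly (S : comNzRingType) (xs : seq S) f :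
  in_ideal xs f -> in_ideal [seq x%:P | x <- xs] f%:P.
Proof.
move=> [c ->]; exists (fun i => (c i)%:P); rewrite size_map rmorph_sum.
by apply: eq_bigr => i _; rewrite rmorphM (nth_map 0).
Qed.

(** Each induction step adjoins an indeterminate and divides by the generic form: the
    Hilbert function is replaced by its first difference, and one element of the
    sequence is spent.  The last Hilbert function is a rank, hence nonnegative. *)
Theorem weakly_regular_bdiff_ge0 (r : nat) :
  forall (A : idomainType) (S : comNzRingType) (phi : {rmorphism A -> S})
    (xs : seq S) (pr : int -> {additive S -> S}) (k : nat) (a : 'I_k -> int)
    (R : 'rV[S]_k -> Prop) (h : int -> nat) (s : seq S),
  is_ring_grading phi xs pr -> is_submodule R ->
  (forall e v, R v -> R (hom_part pr a e v)) ->
  (forall e, has_rank phi R (is_hom pr a e) (h e)) ->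
  {in s, forall f, in_ideal xs f} -> weakly_regular R s -> size s = r ->
  forall e, 0 <= iter r bdiff (fun e => (h e)%:Z) e.
Proof.
elim: r => [//|r IHr] A S phi xs pr k a R h [//|f s] Hpr HR Rhom Hrk xs_s reg [szs] e.
set g := generic_form xs; set R' := add_multiples (poly_ext R) g.
have HX := poly_ext_submodule HR.
have gdeg := generic_form_degree Hpr.
have Hpr' := poly_ring_grading Hpr.
have greg : forall v, poly_ext R (g *: v) -> poly_ext R v.
  move=> v; apply: generic_form_nonzerodivisor => // {}v Hv.
  apply: reg.1; apply: in_ideal_killed Hv => //; apply: xs_s; exact: mem_head.
have Xhom e' v : poly_ext R v -> poly_ext R (hom_part (poly_pr pr) a e' v).
  by move=> Hv j; rewrite coefv_hom_part; exact: Rhom.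
have Hq e' : (h (e' - 1)%R <= h e')%N /\ has_rank (map_poly phi) R'
    (is_hom (poly_pr pr) a e') (h e' - h (e' - 1)%R).
  apply: (@has_rank_quotient _ _ _ _ _ (is_hom (poly_pr pr) a (e' - 1))) => //.
  - exact: (is_hom_subspace _ Hpr').
  - by move=> v Hv; rewrite /is_hom hom_part_mul // Hv.
  - move=> v Hv [w Rw]; exists (hom_part (poly_pr pr) a (e' - 1) w).
      exact: (hom_part_idem _ Hpr').
    by rewrite -Hv -hom_part_mul // -hom_partN -hom_partD; exact: Xhom.
  - exact: (has_rank_poly_ext HR (Hrk _)).
  - exact: (has_rank_poly_ext HR (Hrk _)).
have -> : iter r.+1 bdiff (fun e => (h e)%:Z) e =
    iter r bdiff (fun e => (h e - h (e - 1)%R)%N%:Z) e.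
  rewrite iterSr; congr (iter r bdiff _ e); apply/funext => e'.
  by rewrite /bdiff -subzn //; have [] := Hq e'.
apply: (IHr _ _ _ _ _ _ _ _ _ _ Hpr' _ _ (fun e => (Hq e).2)
          _ (generic_form_regular HR xs_s reg)).
- exact: add_multiples_submodule.
- move=> e' v [w Rw]; exists (hom_part (poly_pr pr) a (e' - 1) w).
  by rewrite -hom_part_mul // -hom_partN -hom_partD; exact: Xhom.
- move=> _ /mapP[f' sf' ->]; apply: in_ideal_poly; apply: xs_s.
  by rewrite lastI mem_rcons inE sf' orbT.
- by rewrite size_map size_belast.
Qed.

(** * The polynomial ring as a graded ring *)

Section InIdeal.
Variables (S : comNzRingType) (xs : seq S).

Lemma in_ideal0 : in_ideal xs 0.
Proof. by exists (fun=> 0); rewrite big1 // => i _; rewrite mul0r. Qed.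

Lemma in_idealD f g : in_ideal xs f -> in_ideal xs g -> in_ideal xs (f + g).
Proof.
move=> [c ->] [d ->]; exists (fun i => c i + d i).
by rewrite -big_split; apply: eq_bigr => i _; rewrite mulrDl.
Qed.

Lemma in_idealMl f g : in_ideal xs g -> in_ideal xs (f * g).
Proof.
move=> [c ->]; exists (fun i => f * c i).
by rewrite mulr_sumr; apply: eq_bigr => i _; rewrite mulrA.
Qed.

Lemma in_ideal_mem x : x \in xs -> in_ideal xs x.
Proof.
move=> xs_x; exists (fun i => (i == index x xs)%:R).
have ltx : (index x xs < size xs)%N by rewrite index_mem.
rewrite (bigD1 (Ordinal ltx)) //= eqxx mul1r nth_index // big1 ?addr0 // => i.
by rewrite -val_eqE /= => /negPf ->; rewrite mul0r.
Qed.

End InIdeal.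

Section PolynomialGrading.
Variables (K : fieldType) (n : nat).
Local Notation S := {mpoly K[n]}.

Definition variables : seq S := [seq 'X_i | i <- enum 'I_n].

Lemma in_ideal_variables (f : S) : f@_0%MM = 0 -> in_ideal variables f.
Proof.
move=> f0; rewrite [f]mpolyE big_seq; apply: big_ind => [|g h|m fm].
- exact: in_ideal0.
- exact: in_idealD.
rewrite -mul_mpolyC; apply: in_idealMl.
have [i mi] : exists i, (0 < m i)%N.
  apply: contrapT => Hm; move: fm; rewrite mcoeff_msupp (_ : m = 0%MM) ?f0 ?eqxx //.
  apply/mnmP => i; rewrite mnm0E; apply/eqP; rewrite -leqn0 leqNgt; apply/negP => mi.
  by apply: Hm; exists i.
rewrite -(@submK _ U_(i)%MM m); last by rewrite lep1mP -lt0n.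
rewrite mpolyXD; apply: in_idealMl; apply: in_ideal_mem.
by apply: map_f; rewrite mem_enum.
Qed.

HB.instance Definition _ (d : int) := GRing.isNmodMorphism.Build S S (hpart d)
  (conj (hpart0 K n d) (@hpartD K n d)).

Definition hpart_additive (d : int) : {additive S -> S} := hpart d.

Lemma hpart_mul e (d : nat) (p f : S) : p \is d.-homog ->
  hpart (d%:Z + e) (p * f) = p * hpart e f.
Proof.
move=> hp; rewrite [f in LHS]hpart_sum [f in RHS]hpart_sum mulr_sumr !raddf_sum mulr_sumr.
apply: eq_bigr => j _ /=.
rewrite (hpart_hpoly _ (hpartP j f)) (hpart_hpoly _ (hpolyM hp (hpartP j f))).
by rewrite (inj_eq (addrI _)); case: eqP => //; rewrite mulr0.
Qed.

Lemma mpoly_ring_grading :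
  is_ring_grading (@mpolyC n K : {rmorphism K -> S}) variables hpart_additive.
Proof.
split=> [e c f|e _ f /mapP[i _ ->]|e f] /=.
- by rewrite -[e in LHS]add0r hpart_mul // -alg_mpolyC dhomogZ ?dhomog1.
- by rewrite addrC (@hpart_mul e 1) // dhomogX /= mdeg1.
- by rewrite (hpart_hpoly _ (hpartP e f)) eqxx.
Qed.

(** Only the degrees carried by some monomial of some entry contribute. *)
Lemma hom_part_decomposition k (a : 'I_k -> int) (v : 'rV[S]_k) :
  exists s : seq int, [/\ uniq s, v = \sum_(e <- s) hom_part hpart_additive a e v
    & forall e, e \notin s -> hom_part hpart_additive a e v = 0].
Proof.
pose t i := [seq j%:Z + a i | j <- iota 0 (msize (v 0 i))].
have ht i e : e \notin t i -> hpart (e - a i) (v 0 i) = 0.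
  move=> et; rewrite [v 0 i]hpart_sum raddf_sum big_map big_seq big1 // => j jt.
  rewrite [LHS](hpart_hpoly _ (hpartP j (v 0 i))).
  case: eqP => // je; case/negP: et.
  by apply/mapP; exists j => //; rewrite je subrK.
exists (undup (flatten [seq t i | i <- enum 'I_k])).
have hs i e : e \notin undup (flatten [seq t i | i <- enum 'I_k]) -> e \notin t i.
  apply: contra => et; rewrite mem_undup; apply/flattenP; exists (t i) => //.
  by rewrite map_f // mem_enum.
split=> [|| e es]; first exact: undup_uniq; last first.
  by apply/rowP => i; rewrite !mxE; apply: ht; exact: hs.
apply/rowP => i; rewrite summxE.
under eq_bigr do rewrite mxE /=.
set s := undup _ in hs *.
have -> : \sum_(e <- s) hpart (e - a i) (v 0 i) =
          \sum_(e <- s | e \in t i) hpart (e - a i) (v 0 i).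
  by rewrite [RHS]big_mkcond; apply: eq_bigr => e _; case: ifPn => // /ht.
rewrite -big_filter (perm_big (t i)) /=; last first.
  apply: uniq_perm; first by rewrite filter_uniq // undup_uniq.
    by rewrite map_inj_uniq ?iota_uniq // => x y /addIr [].
  move=> e; rewrite mem_filter andb_idr // => et.
  by apply: contraLR et => /hs.
rewrite {1}[v 0 i]hpart_sum !big_map; apply: eq_bigr => j _.
by rewrite addrK.
Qed.

End PolynomialGrading.

(** * Presentations of finitely generated graded modules *)

Lemma ideal_mul_rcons (K : fieldType) (n : nat) (N : lmodType {mpoly K[n]})
    (t : seq {mpoly K[n]}) f (x : N) :
  ideal_mul (rcons t f) x <-> exists y, ideal_mul t (x - f *: y).
Proof.
split=> [[w ->]|[y [w xE]]].
  move: w; rewrite size_rcons => w; exists (w ord_max).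
  exists (fun i => w (widen_ord (leqnSn _) i)).
  rewrite big_ord_recr /= nth_rcons ltnn eqxx addrK.
  by apply: eq_bigr => i _; rewrite nth_rcons ltn_ord.
pose w' (i : nat) := if insub i is Some j then w j else y.
exists (fun i => w' i); move: (x) xE => x' /eqP; rewrite subr_eq => /eqP ->.
rewrite size_rcons big_ord_recr /= nth_rcons ltnn eqxx /w' insubN ?ltnn //.
congr (_ + _); apply: eq_bigr => i _.
by rewrite nth_rcons ltn_ord valK.
Qed.

Section GradedModule.
Variables (K : fieldType) (n : nat) (N : graded_module K n).
Local Notation S := {mpoly K[n]}.
Local Notation C := (hcomp N).
Local Notation HN := (hcomp_grading N).

Lemma hcompN d (v : N) : C d v -> C d (- v).
Proof.
move=> Cv; rewrite -scaleN1r -[d]add0r; apply: (gradZ HN) => //.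
by rewrite dhomogN; exact: dhomog1.
Qed.

Lemma hcomp_sum d (I : Type) (r : seq I) (P : pred I) (F : I -> N) :
  (forall i, P i -> C d (F i)) -> C d (\sum_(i <- r | P i) F i).
Proof.
by move=> CF; apply: big_ind => //; [exact: (grad0 HN) | exact: (gradD HN)].
Qed.

Lemma hcomp_component (s : seq int) (f : int -> N) e (v : N) :
  uniq s -> (forall d, C d (f d)) -> v = \sum_(d <- s) f d -> C e v ->
  v = if e \in s then f e else 0.
Proof.
move=> us Cf vE Cv.
pose f' d := (if d \in s then f d else 0) - (if d == e then v else 0).
have Cf' d : C d (f' d).
  apply: (gradD HN); first by case: ifP => _; [exact: Cf | exact: (grad0 HN)].
  by apply: hcompN; case: eqP => [->|_] //; exact: (grad0 HN).
have [t ut tE] : exists2 t, uniq t & t =i e :: s.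
  by exists (undup (e :: s)); [exact: undup_uniq | exact: mem_undup].
have /(_ e) : forall d, d \in t -> f' d = 0.
  apply: (grad_free HN) => //; rewrite sumrB; apply/eqP; rewrite subr_eq0; apply/eqP.
  rewrite -[LHS]big_mkcond -[RHS]big_mkcond -[LHS]big_filter -[RHS]big_filter.
  rewrite (perm_big s) /=; last first.
    apply: uniq_perm; rewrite ?filter_uniq // => d.
    by rewrite mem_filter tE inE; case: (d \in s); rewrite ?orbT.
  rewrite -vE (perm_big [:: e]) ?big_seq1 //.
  apply: uniq_perm; rewrite ?filter_uniq // => d.
  by rewrite mem_filter tE !inE; case: eqP.
rewrite tE mem_head /f' eqxx => /(_ isT)/eqP.
by rewrite subr_eq0 => /eqP <-.
Qed.

(** The components of the given generators generate as well. *)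
Lemma homogeneous_generators : finitely_generated N ->
  exists (k : nat) (a : 'I_k -> int) (g : 'I_k -> N),
    (forall i, C (a i) (g i)) /\
    forall v, exists c : 'I_k -> S, v = \sum_i c i *: g i.
Proof.
case=> k0 [g0 gen0].
have /choice[s /choice[f Hsf]] i : exists (s : seq int) (f : int -> N),
  (forall d, C d (f d)) /\ g0 i = \sum_(d <- s) f d by exact: grad_span HN (g0 i).
pose T : finType := {i : 'I_k0 & 'I_(size (s i))}.
pose a (t : T) := (s (tag t))`_(tagged t).
exists #|T|, (a \o enum_val), (fun i => let t : T := enum_val i in f (tag t) (a t)).
split=> [i|v]; first exact: (Hsf _).1.
have [c ->] := gen0 v; exists (fun i => let t : T := enum_val i in c (tag t)).
rewrite -(big_enum_val (fun t : T => c (tag t) *: f (tag t) (a t))) /=.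
have -> : \sum_(i < k0) c i *: g0 i =
    \sum_(i < k0) \sum_(j < size (s i)) c i *: f i (s i)`_j.
  apply: eq_bigr => i _; rewrite (Hsf i).2 scaler_sumr.
  by rewrite (big_nth 0) big_mkord.
rewrite sig_big_dep /=.
by apply: eq_bigl => t; rewrite inE.
Qed.

Section Presentation.
Variables (k : nat) (a : 'I_k -> int) (g : 'I_k -> N).
Hypothesis Cg : forall i, C (a i) (g i).
Hypothesis gen : forall v : N, exists c : 'I_k -> S, v = \sum_i c i *: g i.
Local Notation V := 'rV[S]_k.
Local Notation hp := (hom_part (@hpart_additive K n) a).

Definition present (v : V) : N := \sum_i v 0 i *: g i.
Definition relations (v : V) : Prop := present v = 0.

Lemma present0 : present 0 = 0.
Proof. by rewrite /present big1 // => i _; rewrite mxE scale0r. Qed.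

Lemma presentD v w : present (v + w) = present v + present w.
Proof.
by rewrite /present -big_split; apply: eq_bigr => i _; rewrite mxE scalerDl.
Qed.

Lemma presentZ f v : present (f *: v) = f *: present v.
Proof.
by rewrite /present scaler_sumr; apply: eq_bigr => i _; rewrite mxE scalerA.
Qed.

Lemma presentB v w : present (v - w) = present v - present w.
Proof. by rewrite presentD -[- w]scaleN1r presentZ scaleN1r. Qed.

Lemma present_sum (I : Type) (r : seq I) (P : pred I) (F : I -> V) :
  present (\sum_(i <- r | P i) F i) = \sum_(i <- r | P i) present (F i).
Proof. exact: (big_morph _ presentD present0). Qed.

Lemma present_surj v : exists w, present w = v.
Proof.
have [c ->] := gen v; exists (\row_i c i).
by apply: eq_bigr => i _; rewrite mxE.
Qed.

Lemma relations_submodule : is_submodule relations.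
Proof.
split=> [|v w Hv Hw|f v Hv]; rewrite /relations; first exact: present0.
  by rewrite presentD Hv Hw addr0.
by rewrite presentZ Hv scaler0.
Qed.

Lemma hcomp_present e v : C e (present (hp e v)).
Proof.
apply: hcomp_sum => i _; rewrite mxE /= /hpart.
case E : (e - a i) => [d|d]; last by rewrite scale0r; exact: (grad0 HN).
rewrite -[e](subrK (a i)) E; apply: (gradZ HN) => //; exact: pihomogP.
Qed.

Lemma present_component e v : C e (present v) -> present v = present (hp e v).
Proof.
move=> Cv; have [s [us vE v0]] := hom_part_decomposition a v.
rewrite {1}(hcomp_component (f := fun d => present (hp d v)) us _ _ Cv).
- by case: ifPn => // /v0 ->; rewrite present0.
- by move=> d; exact: hcomp_present.
- by rewrite {1}vE present_sum.
Qed.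

Lemma relations_hom_part e v : relations v -> relations (hp e v).
Proof.
move=> Hv; rewrite /relations -present_component ?Hv //; exact: (grad0 HN).
Qed.

(** A basis of a component of N lifts to homogeneous rows. *)
Lemma present_rank e h : has_dim (C e) h ->
  has_rank (@mpolyC n K : {rmorphism K -> S}) relations
           (is_hom (@hpart_additive K n) a e) h.
Proof.
case=> b [Cb bas].
have /choice[u Hu] i : exists u, is_hom (@hpart_additive K n) a e u /\ present u = b i.
  have [u uE] := present_surj (b i); exists (hp e u); split.
    exact: (hom_part_idem _ (mpoly_ring_grading K n)).
  by rewrite -present_component uE.
exists 'I_h, u; split=> [|i|c Hc|v Hv]; first by rewrite card_ord.
- by have [] := Hu i.
- have [c0 [_ unique_c]] := bas 0 (grad0 HN e).
  have E0 : c0 = [ffun=> 0].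
    apply: unique_c; rewrite big1 // => i _; by rewrite ffunE scale0r.
  have Ec : c0 = [ffun i => c i].
    apply: unique_c; rewrite -[LHS]Hc present_sum; apply: eq_bigr => i _.
    by rewrite ffunE presentZ (Hu i).2.
  by move=> i; have := congr1 (fun f : {ffun _ -> _} => f i) Ec; rewrite E0 !ffunE.
have [|c [vE _]] := bas (present v).
  by rewrite -Hv; exact: hcomp_present.
exists 1, c; split; first exact: oner_neq0.
rewrite rmorph1 scale1r /relations presentB vE present_sum.
apply/eqP; rewrite subr_eq0; apply/eqP; apply: eq_bigr => i _.
by rewrite presentZ (Hu i).2.
Qed.

Lemma present_regular (t s : seq S) :
  (forall i (v : N), (i < size (t ++ s))%N ->
     ideal_mul (take i (t ++ s)) ((t ++ s)`_i *: v) -> ideal_mul (take i (t ++ s)) v) ->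
  weakly_regular (fun v => ideal_mul t (present v)) s.
Proof.
elim: s t => [//|f s IHs] t Hreg; split=> [v|].
  rewrite presentZ => Hv; have := Hreg (size t) (present v).
  rewrite size_cat /= -[X in (X < _)%N]addn0 ltn_add2l => /(_ isT).
  by rewrite take_size_cat // nth_cat ltnn subnn; apply.
apply: weakly_regular_ext (IHs (rcons t f) _); last by rewrite cat_rcons.
move=> v; rewrite ideal_mul_rcons; split=> [[y]|[w Hw]].
  by have [w <-] := present_surj y; rewrite -presentZ -presentB; exists w.
by exists (present w); rewrite -presentZ -presentB.
Qed.

End Presentation.

(** Elements without constant term lie in the ideal of the variables, so the previous
    theorem applies to a presentation of N by homogeneous generators. *)
Theorem regular_sequence_bdiff_ge0 (h : int -> nat) (s : seq S) :
  finitely_generated N -> (forall e, has_dim (C e) (h e)) ->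
  regular_sequence N s -> forall e, 0 <= iter (size s) bdiff (fun e => (h e)%:Z) e.
Proof.
move=> /homogeneous_generators[k [a [g [Cg gen]]]] Hh [s0 reg _].
apply: (weakly_regular_bdiff_ge0 (mpoly_ring_grading K n)
  (relations_submodule g) (relations_hom_part Cg)
  (fun e => present_rank Cg gen (Hh e))) => //.
  by move=> f sf; apply: in_ideal_variables; exact: s0.
apply: weakly_regular_ext (@present_regular _ g gen [::] s _) => [v|]; last exact: reg.
split=> [[w wE]|Hv]; first by rewrite /relations wE big_ord0.
by exists (fun _ => 0); rewrite big_ord0; exact: Hv.
Qed.

End GradedModule.

(** * Counting monomials *)

Section Monomials.
Variable n : nat.
Implicit Types (m : 'X_{1..n}) (P : pred 'X_{1..n}).

Definition mnm_of_ffun B (f : {ffun 'I_n -> 'I_B}) : 'X_{1..n} :=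
  [multinom (f i : nat) | i < n].

Definition monomials P (e : nat) : seq 'X_{1..n} :=
  [seq m <- [seq mnm_of_ffun f | f : {ffun 'I_n -> 'I_e.+1}] | (mdeg m == e) && P m].

Lemma mnm_of_ffun_inj B : injective (@mnm_of_ffun B).
Proof.
move=> f g /mnmP fg; apply/ffunP => i; apply: val_inj.
by have := fg i; rewrite !mnmE.
Qed.

Lemma mnm_of_ffunP B m : (mdeg m < B)%N -> exists f, m = @mnm_of_ffun B f.
Proof.
move=> mB; have mi i : (m i < B)%N.
  by apply: leq_ltn_trans mB; rewrite mdegE (bigD1 i) //= leq_addr.
by exists [ffun i => Ordinal (mi i)]; apply/mnmP => i; rewrite mnmE ffunE.
Qed.

Lemma mem_monomials P e m : (m \in monomials P e) = (mdeg m == e) && P m.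
Proof.
rewrite mem_filter andb_idr // => /andP[/eqP me _].
have [|f ->] := @mnm_of_ffunP e.+1 m; first by rewrite me.
exact: image_f.
Qed.

Lemma monomials_uniq P e : uniq (monomials P e).
Proof.
by rewrite filter_uniq // map_inj_uniq ?enum_uniq //; exact: mnm_of_ffun_inj.
Qed.

Lemma size_monomials B P e : (e < B)%N ->
  size (monomials P e) = #|[pred f : {ffun 'I_n -> 'I_B} |
    (mdeg (mnm_of_ffun f) == e) && P (mnm_of_ffun f)]|.
Proof.
move=> eB; rewrite cardE -(size_map (@mnm_of_ffun B)).
apply/perm_size/uniq_perm; first exact: monomials_uniq.
  by rewrite map_inj_uniq ?enum_uniq //; exact: mnm_of_ffun_inj.
move=> m; rewrite mem_monomials; apply/idP/mapP => [Hm|[f]].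
  have [|f mf] := @mnm_of_ffunP B m; first by have /andP[/eqP->] := Hm.
  by exists f => //; rewrite mem_enum inE -mf.
by rewrite mem_enum inE => Hf ->.
Qed.

(** Expanding the product over the variables of the sums of allowed powers of X gives
    one term X^(deg m) for each monomial m with allowed exponents; exponents below
    B suffice in degrees below B. *)
Lemma size_monomials_product (allowed : 'I_n -> pred nat) B e : (e < B)%N ->
  (size (monomials (fun m => [forall i, allowed i (m i)]) e))%:Z
  = (\prod_(i < n) \sum_(j < B | allowed i j) 'X^j : {poly int})`_e.
Proof.
move=> eB; rewrite (size_monomials _ eB).
under eq_bigr do rewrite big_mkcond.
rewrite bigA_distr_bigA coef_sum -sum1_card -natz natr_sum big_mkcond /=.
apply: eq_bigr => f _; rewrite inE.
have -> : [forall i, allowed i (mnm_of_ffun f i)] = [forall i, allowed i (f i)].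
  by apply: eq_forallb => i; rewrite mnmE.
have -> : mdeg (mnm_of_ffun f) = (\sum_i f i)%N.
  by rewrite mdegE; apply: eq_bigr => i _; rewrite mnmE.
have [/forallP al|] := boolP [forall i, allowed i (f i)]; last first.
  rewrite negb_forall => /existsP[i /negPf al].
  by rewrite andbF (bigD1 i) //= al mul0r coef0.
rewrite andbT (eq_bigr (fun i => 'X^(f i))) => [|i _]; last by rewrite al.
by rewrite prodrXr coefXn eq_sym; case: eqP.
Qed.

Definition mnm_support m : {set 'I_n} := [set i | m i != 0%N].

Definition mnm_in (V : pred 'I_n) m := [forall i, (m i == 0%N) || V i].

Definition low r := mnm_in (fun i => (i < r)%N).

End Monomials.

(** The series 1/(1 - X), truncated below degree B. *)
Definition geom B : {poly int} := \sum_(j < B) 'X^j.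

(** Each of r variables contributes a factor 1/(1 - X). *)
Lemma size_monomials_low n r B e : (e < B)%N -> (r <= n)%N ->
  (size (monomials (@low n r) e))%:Z = (geom B ^+ r)`_e.
Proof.
move=> eB rn.
rewrite (size_monomials_product (fun i j => (j == 0%N) || (i < r)%N) eB).
congr (_`_e); rewrite (bigID (fun i : 'I_n => (i < r)%N)) /= [X in _ * X]big1 ?mulr1.
  rewrite (big_ord_narrow rn) (eq_bigr (fun=> geom B)).
    by rewrite prodr_const card_ord.
  by move=> i _; apply: eq_bigl => j; rewrite /= ltn_ord orbT.
move=> i /negPf ir; case: B eB => // B _.
by rewrite (big_pred1 ord0) ?expr0 // => j; rewrite ir orbF.
Qed.

(** Each variable of the support contributes a factor X/(1 - X), which is one less
    than 1/(1 - X). *)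
Lemma size_monomials_support n (F : {set {set 'I_n}}) B e : (e < B)%N ->
  (size (monomials (fun m => mnm_support m \in F) e))%:Z
  = (\sum_(A in F) (geom B - 1) ^+ #|A|)`_e.
Proof.
move=> eB; rewrite -sum1_size /monomials big_filter.
under eq_bigl do rewrite andbC.
rewrite (partition_big (@mnm_support n) (fun A => A \in F)) /=; last by move=> m /andP[].
rewrite coef_sum -natz natr_sum; apply: eq_bigr => A AF.
have -> : (geom B - 1) ^+ #|A| =
   \prod_(i < n) \sum_(j < B | (i \in A) == (j != 0 :> nat)) 'X^j.
  rewrite (bigID (fun i => i \in A)) /= [X in _ * X]big1 ?mulr1.
    rewrite (eq_bigr (fun=> geom B - 1)) ?prodr_const // => i iA.
    case: B eB => // B _; rewrite /geom big_ord_recl expr0 addrAC subrr add0r iA.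
    by rewrite big_mkcond big_ord_recl /= add0r; apply: eq_bigr.
  move=> i /negPf iA; case: B eB => // B _.
  by rewrite (big_pred1 ord0) ?expr0 // => j; rewrite iA; case: j => [[|j] ltj].
rewrite -(size_monomials_product (fun i j => (i \in A) == (j != 0%N)) eB) -sum1_size.
rewrite big_filter natz; congr (Posz _); apply: eq_bigl => m.
have -> : [forall i, (i \in A) == (m i != 0%N)] = (mnm_support m == A).
  apply/forallP/eqP => [Hm|<- i]; last by rewrite inE.
  by apply/setP => i; rewrite inE (eqP (Hm i)).
by case: (mnm_support m =P A) => [->|]; rewrite ?AF ?andbF ?andbT.
Qed.

(** * Dimensions of graded components *)

Section Dimension.
Variables (K : fieldType) (n : nat) (M : lmodType {mpoly K[n]}).
Implicit Types (W : M -> Prop).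

Lemma has_dim_seq (T : eqType) W (l : seq T) (b : T -> M) : uniq l ->
  {in l, forall t, W (b t)} ->
  (forall v, W v -> exists c : T -> K, v = \sum_(t <- l) (c t)%:MP *: b t) ->
  (forall c : T -> K, \sum_(t <- l) (c t)%:MP *: b t = 0 -> {in l, forall t, c t = 0}) ->
  has_dim W (size l).
Proof.
move=> ul Wb span indep; pose b' (i : 'I_(size l)) := b (tnth (in_tuple l) i).
exists b'; split=> [i|v Wv]; first by apply: Wb; exact: mem_tnth.
have [c ->] := span v Wv.
exists [ffun i => c (tnth (in_tuple l) i)]; split.
  by rewrite big_tnth; apply: eq_bigr => i _; rewrite ffunE.
move=> d; rewrite big_tnth => /eqP; rewrite -subr_eq0 -sumrB => /eqP Hd.
pose e t := c t - (if insub (index t l) is Some i then d i else 0).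
have eE i : e (tnth (in_tuple l) i) = c (tnth (in_tuple l) i) - d i.
  rewrite /e; case: insubP => [j _ ji|]; last by rewrite index_mem mem_tnth.
  congr (_ - d _); apply: val_inj; rewrite ji (tnth_nth (tnth (in_tuple l) i)).
  by rewrite index_uniq.
apply/ffunP => i; rewrite ffunE; apply/eqP; rewrite -subr_eq0 -eE; apply/eqP.
apply: (indep e); last exact: mem_tnth.
rewrite big_tnth -[RHS]Hd; apply: eq_bigr => j _.
by rewrite eE mpolyCB scalerBl.
Qed.

Lemma has_dim_leq W j k : W 0 -> has_dim W j -> has_dim W k -> (j <= k)%N.
Proof.
move=> W0 [b [Wb basb]] [u [Wu basu]]; rewrite leqNgt; apply/negP => ltkj.
have /choice[B HB] i : exists c : {ffun 'I_k -> K}, b i = \sum_l (c l)%:MP *: u l.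
  by have [c []] := basu _ (Wb i); exists c.
have [c [i ci] cB] := linear_dependence (fun i l => B i l) ltkj.
have [c0 [_ uc]] := basb 0 W0.
have E1 : c0 = [ffun=> 0].
  by apply: uc; rewrite big1 // => l _; rewrite ffunE scale0r.
have E2 : c0 = [ffun l => c l].
  apply: uc; under eq_bigr => l _ do rewrite HB scaler_sumr ffunE.
  rewrite exchange_big /= big1 // => l _.
  under eq_bigr do rewrite scalerA -mpolyCM.
  by rewrite -scaler_suml -(raddf_sum (@mpolyC n K)) cB raddf0 scale0r.
have := congr1 (fun f : {ffun _ -> _} => f i) E2.
by rewrite E1 !ffunE => /esym/eqP; rewrite (negPf ci).
Qed.

Lemma has_dim_inj W j k : W 0 -> has_dim W j -> has_dim W k -> j = k.
Proof.
by move=> W0 Hj Hk; apply/eqP; rewrite eqn_leq !(has_dim_leq W0).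
Qed.

Lemma has_dim0 W : W 0 -> (forall v, W v -> v = 0) -> has_dim W 0.
Proof.
move=> W0 HW; exists (fun i : 'I_0 => 0); split=> [[]//|v /HW ->].
exists [ffun=> 0]; split=> [|c _]; first by rewrite big_ord0.
by apply/ffunP => -[].
Qed.

End Dimension.

Lemma mpoly_seqE (K : fieldType) n (l : seq 'X_{1..n}) (p : {mpoly K[n]}) : uniq l ->
  {subset msupp p <= l} -> p = \sum_(m <- l) p@_m *: 'X_[m].
Proof.
move=> ul sub; apply/mpolyP => m; rewrite raddf_sum /=.
under eq_bigr do rewrite mcoeffZ mcoeffX.
have [ml|ml] := boolP (m \in l).
  rewrite (bigD1_seq m) //= eqxx mulr1 big1 ?addr0 // => m' /negPf ->.
  by rewrite mulr0.
rewrite big_seq big1 => [|m' m'l]; last first.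
  by case: eqP => [E|_]; [rewrite -E m'l in ml | rewrite mulr0].
by apply: memN_msupp_eq0; apply: contra ml => /sub.
Qed.

Lemma mcoeff_lincomb (K : fieldType) n (l : seq 'X_{1..n}) (c : 'X_{1..n} -> K) m :
  uniq l -> (\sum_(m <- l) c m *: 'X_[m] : {mpoly K[n]})@_m = if m \in l then c m else 0.
Proof.
move=> ul; rewrite raddf_sum /=; under eq_bigr do rewrite mcoeffZ mcoeffX.
case: ifPn => ml.
  rewrite (bigD1_seq m) //= eqxx mulr1 big1 ?addr0 // => m' /negPf ->.
  by rewrite mulr0.
rewrite big_seq big1 // => m' m'l.
by case: eqP => [E|_]; [rewrite -E m'l in ml | rewrite mulr0].
Qed.

Definition monomialsZ n (P : pred 'X_{1..n}) (e : int) : seq 'X_{1..n} :=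
  if e is Posz d then monomials P d else [::].

Definition monomial_count n (P : pred 'X_{1..n}) (e : int) : nat :=
  size (monomialsZ P e).

(** * Hilbert functions of a squarefree monomial ideal and its quotient *)

Section SquarefreeIdeal.
Variables (K : fieldType) (n : nat) (I : idealr {mpoly K[n]}).
Hypothesis Isf : squarefree_monomial_ideal I.
Local Notation S := {mpoly K[n]}.

Definition mnm_of_set (A : {set 'I_n}) : 'X_{1..n} := [multinom (i \in A : nat) | i < n].

(** The up-closed family of sets A with x_A in I; its complement is the
    Stanley-Reisner complex of I. *)
Definition squarefree_supports : {set {set 'I_n}} := [set A | 'X_[mnm_of_set A] \in I].

Lemma mpolyX_mem_dvd m m' : (m <= m')%MM -> 'X_[m] \in I -> ('X_[m'] : S) \in I.
Proof. by move=> /submK <- Xm; rewrite mpolyXD idealMr. Qed.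

Lemma generator_dvd p m : p \in I -> m \in msupp p ->
  exists A : {set 'I_n}, 'X_[mnm_of_set A] \in I /\ (mnm_of_set A <= m)%MM.
Proof.
have [k [g [g1 HG]]] := Isf => /HG[c pE] mp.
have [j gm] : exists j, m \in msupp (c j * 'X_[g j]).
  apply: contrapT => H; move: mp; rewrite mcoeff_msupp => /eqP; apply.
  rewrite pE raddf_sum /= big1 // => j _.
  by apply: memN_msupp_eq0; apply/negP => gm; apply: H; exists j.
exists (mnm_support (g j)).
have -> : mnm_of_set (mnm_support (g j)) = g j.
  apply/mnmP => i; rewrite mnmE inE; have := g1 j i.
  by case: (g j i) => [|[]].
split.
  apply/HG; exists (fun i => (i == j)%:R); rewrite (bigD1 j) //= eqxx mul1r.
  by rewrite big1 ?addr0 // => i /negPf ->; rewrite mul0r.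
move: gm; rewrite (perm_mem (msuppMX _ _)) => /mapP[m' _ ->].
by apply/mnm_lepP => i; rewrite mnmDE leq_addr.
Qed.

(** Membership of a monomial depends on its support only, as the generators are
    squarefree. *)
Lemma mpolyX_mem m : (('X_[m] : S) \in I) = (mnm_support m \in squarefree_supports).
Proof.
rewrite inE; apply/idP/idP => [Xm|]; last first.
  apply: mpolyX_mem_dvd; apply/mnm_lepP => i; rewrite mnmE inE.
  by case: (m i).
have [|A [XA Am]] := generator_dvd Xm (m := m); first by rewrite msuppX inE.
apply: mpolyX_mem_dvd XA; apply/mnm_lepP => i; rewrite !mnmE inE.
move/mnm_lepP/(_ i): Am; rewrite mnmE; case: (i \in A) => //.
by rewrite -lt0n => ->.
Qed.

Lemma mem_ideal p :
  (p \in I) <-> {in msupp p, forall m, mnm_support m \in squarefree_supports}.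
Proof.
split=> [pI m mp|Hp].
  have [A [XA Am]] := generator_dvd pI mp.
  by rewrite -mpolyX_mem; exact: mpolyX_mem_dvd XA.
rewrite [p]mpolyE big_seq; apply: rpred_sum => m mp.
by rewrite -mul_mpolyC; apply: idealMr; rewrite mpolyX_mem; exact: Hp.
Qed.

Lemma squarefree_supports_up (A B : {set 'I_n}) :
  A \subset B -> A \in squarefree_supports -> B \in squarefree_supports.
Proof.
move=> /subsetP AB; rewrite !inE; apply: mpolyX_mem_dvd; apply/mnm_lepP => i.
rewrite !mnmE; case: (boolP (i \in A)) => // /AB ->; exact: leqnn.
Qed.

Lemma squarefree_supports0 : set0 \notin squarefree_supports.
Proof.
rewrite inE (_ : mnm_of_set _ = 0%MM).
  by rewrite mpolyX0 idealr1.
by apply/mnmP => i; rewrite mnmE mnm0E inE.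
Qed.

Lemma squarefree_supportsT : (exists2 p, p \in I & p != 0) ->
  [set: 'I_n] \in squarefree_supports.
Proof.
case=> p pI; rewrite -msupp_eq0; case E : (msupp p) => [//|m l] _.
apply: squarefree_supports_up (subsetT (mnm_support m)) _.
by apply: ((mem_ideal p).1) => //; rewrite E mem_head.
Qed.

Lemma dhomog_support (P : pred 'X_{1..n}) (p : S) (d : nat) : p \is d.-homog ->
  {in msupp p, forall m, P m} -> p = \sum_(m <- monomials P d) p@_m *: 'X_[m].
Proof.
move=> /dhomogP hp Pp; apply: mpoly_seqE; first exact: monomials_uniq.
by move=> m mp; rewrite mem_monomials (hp _ mp) eqxx /=; exact: Pp.
Qed.

Lemma ideal_has_dim e :
  has_dim (hcomp (ideal_gmod (squarefree_monomial_homogeneous Isf)) e)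
          (monomial_count (fun m => mnm_support m \in squarefree_supports) e).
Proof.
rewrite /monomial_count; case: e => d /=; last first.
  by apply: has_dim0 => // v Hv; apply: val_inj; exact: Hv.
set l := monomials _ d.
have val_b m : m \in l -> val (insubd 0 'X_[m] : ideal_module I) = 'X_[m].
  by rewrite mem_monomials -mpolyX_mem => /andP[_ Xm]; rewrite insubdK.
have val_sum (c : 'X_{1..n} -> K) :
    val (\sum_(m <- l) (c m)%:MP *: (insubd 0 'X_[m] : ideal_module I)) =
    \sum_(m <- l) c m *: 'X_[m].
  rewrite raddf_sum /= big_seq [RHS]big_seq; apply: eq_bigr => m ml.
  by rewrite -mul_mpolyC -[in RHS]val_b.
apply: (has_dim_seq (b := fun m => (insubd 0 'X_[m] : ideal_module I))).
- exact: monomials_uniq.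
- move=> m ml; rewrite /hcomp /= /ideal_hcomp val_b //= dhomogX.
  by move: ml; rewrite mem_monomials => /andP[].
- move=> v Hv; exists (fun m => (val v)@_m); apply: val_inj; rewrite val_sum.
  by apply: dhomog_support => //; apply/mem_ideal; exact: ideal_valP.
- move=> c /(congr1 val); rewrite val_sum raddf0 => Hc m ml.
  by rewrite -[0](mcoeff0 _ m) -Hc mcoeff_lincomb ?monomials_uniq // ml.
Qed.

Lemma quotient_has_dim e :
  has_dim (hcomp (quotient_gmod (squarefree_monomial_homogeneous Isf)) e)
          (monomial_count (fun m => mnm_support m \in ~: squarefree_supports) e).
Proof.
rewrite /monomial_count; case: e => d /=; last first.
  apply: has_dim0 => [|v [p -> ->]]; last exact: quotient_proj0.
  by exists 0; rewrite ?quotient_proj0.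
set l := monomials _ d.
have proj_sum (c : 'X_{1..n} -> K) :
    \sum_(m <- l) (c m)%:MP *: quotient_proj I 'X_[m] =
    quotient_proj I (\sum_(m <- l) c m *: 'X_[m]).
  rewrite quotient_proj_sum; apply: eq_bigr => m _.
  by rewrite -mul_mpolyC quotient_projZ.
apply: (has_dim_seq (b := fun m => quotient_proj I 'X_[m])); first exact: monomials_uniq.
- move=> m; rewrite mem_monomials => /andP[md _].
  by exists 'X_[m] => //=; rewrite dhomogX.
- move=> _ [p hp ->]; exists (fun m => p@_m); rewrite proj_sum.
  apply/eqP; rewrite -subr_eq0; apply/eqP.
  have -> : quotient_proj I p - quotient_proj I (\sum_(m <- l) p@_m *: 'X_[m]) =
     quotient_proj I (p - \sum_(m <- l) p@_m *: 'X_[m]).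
    by rewrite quotient_projD -[- _ in RHS]mulN1r quotient_projZ scaleN1r.
  apply/quotient_proj_eq0/mem_ideal => m; rewrite mcoeff_msupp mcoeffB.
  rewrite mcoeff_lincomb ?monomials_uniq // mem_monomials inE.
  have [md|md] := eqVneq (mdeg m) d; last first.
    by rewrite (dhomog_nemf_coeff hp) //= subrr eqxx.
  by case: (_ \in squarefree_supports) => //=; rewrite subrr eqxx.
- move=> c; rewrite proj_sum => /quotient_proj_eq0/mem_ideal Hc m ml.
  apply/eqP; apply: contraT => cm; have := Hc m.
  rewrite mcoeff_msupp mcoeff_lincomb ?monomials_uniq // ml => /(_ cm).
  by move: ml; rewrite mem_monomials inE => /andP[_ /negPf ->].
Qed.

End SquarefreeIdeal.

(** * Killing variables *)

Section Keep.
Variables (K : fieldType) (n : nat).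
Local Notation S := {mpoly K[n]}.
Implicit Types (P : pred 'I_n) (p : S).

Definition keep P : S -> S :=
  comp_mpoly [tuple if P i then 'X_i else 0 | i < n].
HB.instance Definition _ P := GRing.RMorphism.copy (keep P) (keep P).

Lemma keepM P p q : keep P (p * q) = keep P p * keep P q.
Proof. exact: rmorphM. Qed.

Lemma keepX P m : keep P 'X_[m] = if mnm_in P m then 'X_[m] else 0.
Proof.
rewrite /keep comp_mpolyX; case: ifPn => [/forallP Hm|].
  rewrite [RHS]mpolyXE_id; apply: eq_bigr => i _; rewrite tnth_mktuple.
  by case/orP: (Hm i) => [/eqP ->|->//]; rewrite !expr0.
rewrite negb_forall => /existsP[i]; rewrite negb_or => /andP[mi /negPf Pi].
by rewrite (bigD1 i) //= tnth_mktuple Pi expr0n (negPf mi) mul0r.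
Qed.

Lemma keepE P p : keep P p = \sum_(m <- msupp p | mnm_in P m) p@_m *: 'X_[m].
Proof.
rewrite {1}[p]mpolyE raddf_sum [RHS]big_mkcond /=; apply: eq_bigr => m _.
by rewrite /keep comp_mpolyZ -/(keep P _) keepX; case: ifP; rewrite ?scaler0.
Qed.

Lemma mcoeff_keep P p m : (keep P p)@_m = if mnm_in P m then p@_m else 0.
Proof.
rewrite keepE raddf_sum /=; under eq_bigr do rewrite mcoeffZ mcoeffX.
have [mp|mp] := boolP (m \in msupp p); last first.
  rewrite (memN_msupp_eq0 mp) if_same big_seq_cond big1 // => m' /andP[m'p _].
  by case: eqP => [E|]; [rewrite -E m'p in mp | rewrite mulr0].
rewrite big_mkcond (bigD1_seq m) ?msupp_uniq //= eqxx mulr1 big1 ?addr0 // => m' /negPf ->.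
by rewrite mulr0 if_same.
Qed.

Lemma keep_idP P p : reflect {in msupp p, forall m, mnm_in P m} (keep P p == p).
Proof.
apply: (iffP eqP) => [pE m|Hp].
  by rewrite mcoeff_msupp -pE mcoeff_keep; case: ifP; rewrite ?eqxx.
apply/mpolyP => m; rewrite mcoeff_keep; case: ifPn => // mP.
by rewrite memN_msupp_eq0 //; apply: contra mP => /Hp.
Qed.

Lemma keep_idem P p : keep P (keep P p) = keep P p.
Proof. by apply/mpolyP => m; rewrite !mcoeff_keep; case: (mnm_in P m). Qed.

Lemma keep_homog P d p : p \is d.-homog -> keep P p \is d.-homog.
Proof.
move=> /dhomogP hp; apply/dhomogP => m.
rewrite mcoeff_msupp mcoeff_keep; case: ifP => _; last by rewrite eqxx.
by rewrite -mcoeff_msupp => /hp.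
Qed.

Lemma keepXU P i : keep P 'X_i = if P i then 'X_i else 0.
Proof. by rewrite /keep comp_mpolyXU -tnth_nth tnth_mktuple. Qed.

Lemma nth_variables d i : (i < d <= n)%N -> exists2 j : 'I_n, j = i :> nat &
  (take d (variables K n))`_i = 'X_j.
Proof.
move=> /andP[id dn]; have ltin := leq_trans id dn.
exists (Ordinal ltin) => //; rewrite nth_take // (nth_map (Ordinal ltin)).
  by congr 'X_ _; apply: val_inj; rewrite /= nth_enum_ord.
by rewrite size_enum_ord.
Qed.

Lemma size_variables d : (d <= n)%N -> size (take d (variables K n)) = d.
Proof. by move=> dn; rewrite size_take_min size_map size_enum_ord; apply/minn_idPl. Qed.

(** A monomial sent to zero contains one of the first d variables. *)
Lemma keep_eq0 d p : (d <= n)%N -> keep (fun i => (d <= i)%N) p = 0 ->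
  in_ideal (take d (variables K n)) p.
Proof.
move=> dn kp; rewrite [p]mpolyE big_seq; apply: big_ind => [|g h|m mp].
- exact: in_ideal0.
- exact: in_idealD.
rewrite -mul_mpolyC; apply: in_idealMl.
have : ~~ mnm_in (fun i => (d <= i)%N) m.
  move: mp; rewrite mcoeff_msupp; apply: contra => mP.
  by have := mcoeff_keep (fun i => (d <= i)%N) p m; rewrite kp mP mcoeff0 => <-.
rewrite negb_forall => /existsP[i]; rewrite negb_or -ltnNge => /andP[mi id].
rewrite -(@submK _ U_(i)%MM m); last by rewrite lep1mP.
rewrite mpolyXD; apply: in_idealMl; apply: in_ideal_mem.
have [|j ji xj] := @nth_variables d i; first by rewrite id.
have <- : j = i by apply: val_inj.
by rewrite -xj mem_nth // size_variables.
Qed.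

End Keep.

(** * Direct sums of shifted polynomial subrings *)

Section StanleyModule.
Variables (K : fieldType) (n : nat) (L : seq (nat * nat)).
Local Notation S := {mpoly K[n]}.
Local Notation q := (size L).

(** An entry (r, a) of L stands for the summand K[x_0, ..., x_(r-1)](-a). *)
Definition stanley_dim (l : 'I_q) := (tnth (in_tuple L) l).1.
Definition stanley_shift (l : 'I_q) : int := (tnth (in_tuple L) l).2%:Z.

Definition stanley_keep (l : 'I_q) : S -> S :=
  keep (fun i : 'I_n => (i < stanley_dim l)%N).
HB.instance Definition _ l := GRing.RMorphism.copy (stanley_keep l) (stanley_keep l).

Definition stanley_pred : {pred 'rV[S]_q} :=
  fun v => [forall l, stanley_keep l (v 0 l) == v 0 l].

Lemma stanley_pred_zmod_closed : zmod_closed stanley_pred.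
Proof.
split=> [|v w /forallP Hv /forallP Hw]; apply/forallP => l; rewrite !mxE.
  by rewrite raddf0.
by rewrite raddfB; apply/eqP; congr (_ - _); apply/eqP; [exact: Hv | exact: Hw].
Qed.
HB.instance Definition _ := GRing.isZmodClosed.Build _ stanley_pred
  stanley_pred_zmod_closed.

(** The direct sum of the modules K[x_0, ..., x_(r-1)](-a) over the entries (r, a) of
    L, realized inside the rows of polynomials.  A polynomial acts on a component
    after its variables of index at least r are set to zero. *)
Record stanley_module := StanleyModule {
  stanley_val :> 'rV[S]_q; _ : stanley_val \in stanley_pred }.

HB.instance Definition _ := [isSub for stanley_val].
HB.instance Definition _ := [Choice of stanley_module by <:].
HB.instance Definition _ := [SubChoice_isSubZmodule of stanley_module by <:].

Lemma stanley_keep_val (v : stanley_module) l :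
  stanley_keep l (val v 0 l) = val v 0 l.
Proof. by case: v => v /= /forallP/(_ l)/eqP. Qed.

Lemma stanley_scale_proof (p : S) (v : stanley_module) :
  \row_l (stanley_keep l p * val v 0 l) \in stanley_pred.
Proof.
apply/forallP => l; rewrite mxE rmorphM /= stanley_keep_val.
by rewrite /stanley_keep keep_idem.
Qed.

Definition stanley_scale (p : S) (v : stanley_module) : stanley_module :=
  StanleyModule (stanley_scale_proof p v).

Lemma stanley_scaleA a b v :
  stanley_scale a (stanley_scale b v) = stanley_scale (a * b) v.
Proof. by apply/val_inj/rowP => l; rewrite !mxE rmorphM mulrA. Qed.
Lemma stanley_scale1 : left_id 1 stanley_scale.
Proof. by move=> v; apply/val_inj/rowP => l; rewrite !mxE rmorph1 mul1r. Qed.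
Lemma stanley_scaleDr : right_distributive stanley_scale +%R.
Proof. by move=> a u v; apply/val_inj/rowP => l; rewrite !mxE mulrDr. Qed.
Lemma stanley_scaleDl v : {morph stanley_scale^~ v : a b / a + b}.
Proof. by move=> a b; apply/val_inj/rowP => l; rewrite !mxE rmorphD mulrDl. Qed.
HB.instance Definition _ := GRing.Zmodule_isLmodule.Build S stanley_module
  stanley_scaleA stanley_scale1 stanley_scaleDr stanley_scaleDl.

End StanleyModule.

Section StanleyTheory.
Variables (K : fieldType) (n : nat) (L : seq (nat * nat)).
Local Notation S := {mpoly K[n]}.
Local Notation q := (size L).
Local Notation M := (stanley_module K n L).
Local Notation sdim := (@stanley_dim L).
Local Notation sshift := (@stanley_shift L).
Local Notation skeep := (@stanley_keep K n L).

(** The default value 0 of [insubd] is never taken, as killing variables is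
    idempotent. *)
Definition stanley_of (v : 'rV[S]_q) : M := insubd 0 (\row_l skeep l (v 0 l)).

Lemma stanley_ofE v l : val (stanley_of v) 0 l = skeep l (v 0 l).
Proof.
rewrite insubdK ?mxE //; apply/forallP => j.
by rewrite mxE /stanley_keep keep_idem.
Qed.

Lemma val_stanley_scale p (v : M) l : val (p *: v) 0 l = skeep l p * val v 0 l.
Proof. by rewrite /= mxE. Qed.

Lemma val_stanley_sum (I : Type) (r : seq I) (P : pred I) (F : I -> M) l :
  val (\sum_(i <- r | P i) F i) 0 l = \sum_(i <- r | P i) val (F i) 0 l.
Proof. by rewrite raddf_sum summxE. Qed.

Definition stanley_hcomp (e : int) : M -> Prop :=
  fun v => forall l, hpoly K n (e - sshift l) (val v 0 l).

Lemma skeep_hpoly l e p : hpoly K n e p -> hpoly K n e (skeep l p).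
Proof.
by case: e => d /=; [exact: keep_homog | move=> ->; rewrite raddf0].
Qed.

Lemma stanley_grading : is_grading stanley_hcomp.
Proof.
split=> [d l|d u v Hu Hv l|e d p v hp Hv l|v|s f us Hf f0 d ds].
- by rewrite mxE; exact: hpoly0.
- by rewrite mxE; exact: hpolyD.
- rewrite val_stanley_scale -addrA; apply: hpolyM => //; exact: keep_homog.
- have [s [_ vE _]] := hom_part_decomposition sshift (val v).
  exists s, (fun e => stanley_of (hom_part (@hpart_additive K n) sshift e (val v))).
  split=> [e l|].
    by rewrite stanley_ofE mxE; apply: skeep_hpoly; exact: hpartP.
  apply/val_inj/rowP => l; rewrite val_stanley_sum -stanley_keep_val {1}vE summxE raddf_sum.
  by apply: eq_bigr => e _; rewrite stanley_ofE.
- apply/val_inj/rowP => l; rewrite [RHS]mxE.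
  pose g e := val (f (e + sshift l)) 0 l.
  have hg e : hpoly K n e (g e) by have := Hf (e + sshift l) l; rewrite addrK.
  have us' : uniq [seq e - sshift l | e <- s].
    by rewrite map_inj_uniq // => x y /addIr.
  have ds' : d - sshift l \in [seq e - sshift l | e <- s] by apply: map_f.
  have := hpart_sum_hpoly us' hg ds'; rewrite big_map /g subrK => <-.
  have -> : \sum_(e <- s) val (f (e - sshift l + sshift l)) 0 l = 0.
    transitivity (val (\sum_(e <- s) f e) 0 l); last by rewrite f0 mxE.
    by rewrite val_stanley_sum; apply: eq_bigr => e _; rewrite subrK.
  exact: hpart0.
Qed.

Definition stanley_gmod : graded_module K n := GradedModule stanley_grading.

Definition stanley_gen l : M := stanley_of (\row_j (j == l)%:R).

Lemma val_stanley_gen l j : val (stanley_gen l) 0 j = (j == l)%:R.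
Proof. by rewrite stanley_ofE mxE rmorph_nat. Qed.

Lemma stanley_span (v : M) : v = \sum_l val v 0 l *: stanley_gen l.
Proof.
apply/val_inj/rowP => j; rewrite val_stanley_sum (bigD1 j) //=.
have E l : val (val v 0 l *: stanley_gen l) 0 j = skeep j (val v 0 l) * (j == l)%:R.
  by rewrite val_stanley_scale val_stanley_gen.
rewrite [X in _ = X + _]E eqxx mulr1 stanley_keep_val big1 ?addr0 // => l.
by rewrite E eq_sym => /negPf ->; rewrite mulr0.
Qed.

Lemma stanley_finitely_generated : finitely_generated stanley_gmod.
Proof.
by exists q, stanley_gen => v; exists (fun l => val (v : M) 0 l); exact: stanley_span.
Qed.

Section Regular.
Variable d : nat.
Hypothesis dn : (d <= n)%N.
Hypothesis dL : forall l, (d <= sdim l)%N.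

Lemma skeep_variable l i : (i < d)%N ->
  skeep l (variables K n)`_i = (variables K n)`_i.
Proof.
move=> id; have [|j ji] := @nth_variables K n d i; first by rewrite id.
rewrite nth_take // => ->; rewrite /stanley_keep keepXU ji.
by rewrite (leq_trans id (dL l)).
Qed.

(** As every summand has at least d variables, the first d variables act on each
    component by plain multiplication, and [keep_eq0] applies componentwise. *)
Lemma stanley_ideal_mul i (v : M) : (i <= d)%N ->
  ideal_mul (take i (variables K n)) v <->
  forall l, keep (fun j : 'I_n => (i <= j)%N) (val v 0 l) = 0.
Proof.
move=> id; have sz := size_variables K (leq_trans id dn).
split=> [[w ->] l|Hv].
  rewrite val_stanley_sum raddf_sum big1 // => j _.
  have jd : (j < i)%N := leq_trans (ltn_ord j) (eq_leq sz).
  rewrite val_stanley_scale [LHS]keepM.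
  have [|k kj] := @nth_variables K n i j; first by rewrite jd (leq_trans id).
  rewrite nth_take // => xk; rewrite skeep_variable ?(leq_trans jd) // xk.
  by rewrite keepXU kj leqNgt jd mul0r.
have /choice[c Hc] l : exists c : nat -> S, val v 0 l =
    \sum_(j < size (take i (variables K n))) c j * (take i (variables K n))`_j.
  by apply: keep_eq0; rewrite ?(leq_trans id).
exists (fun j => stanley_of (\row_l c l j)).
apply/val_inj/rowP => l; rewrite val_stanley_sum -stanley_keep_val Hc raddf_sum.
apply: eq_bigr => j _; rewrite val_stanley_scale stanley_ofE mxE.
by rewrite [LHS]keepM mulrC.
Qed.

Lemma stanley_regular : (0 < q)%N ->
  regular_sequence stanley_gmod (take d (variables K n)).
Proof.
move=> q0; split=> [f|i v|].
- move=> /mem_take/mapP[i _ ->]; rewrite mcoeffX.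
  by case: eqP => // /(congr1 (@mdeg n)); rewrite mdeg1 mdeg0.
- rewrite size_variables // => id; rewrite take_takel 1?ltnW //.
  rewrite !stanley_ideal_mul 1?ltnW // => Hv l; have := Hv l.
  rewrite val_stanley_scale keepM nth_take // skeep_variable //.
  have [|j ji] := @nth_variables K n d i; first by rewrite id.
  rewrite nth_take // => ->; rewrite keepXU ji leqnn => /eqP.
  rewrite mulf_eq0 => /orP[/eqP/(congr1 (mcoeff U_(j)%MM))|/eqP //].
  by rewrite mcoeffXU eqxx mcoeff0 => /eqP; rewrite oner_eq0.
exists (stanley_gen (Ordinal q0)) => /(stanley_ideal_mul _ (leqnn d))/(_ (Ordinal q0)).
by rewrite val_stanley_gen eqxx rmorph1 => /eqP; rewrite oner_eq0.
Qed.

End Regular.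

Lemma stanley_has_dim e : has_dim (hcomp stanley_gmod e)
  (\sum_(x <- L) monomial_count (@low n x.1) (e - x.2%:Z))%N.
Proof.
pose mons (l : 'I_q) := monomialsZ (@low n (sdim l)) (e - sshift l).
pose T : eqType := ('I_q * 'X_{1..n})%type.
pose l : seq T := [seq (i, m) | i <- enum 'I_q, m <- mons i].
pose b (t : T) : M := stanley_of (\row_j (if j == t.1 then 'X_[t.2] else 0)).
have memP i m : (i, m) \in l -> m \in mons i.
  by move=> /allpairsPdep[j [m' [_ Hm [-> ->]]]].
have lowP i m : m \in mons i -> low (sdim i) m && ((mdeg m)%:Z == e - sshift i).
  rewrite /mons; case: (e - _) => [d|d] //=.
  by rewrite mem_monomials andbC => /andP[-> /eqP ->] /=.
have valb i m j : m \in mons i -> val (b (i, m)) 0 j = if j == i then 'X_[m] else 0.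
  move=> /lowP/andP[lm _]; rewrite stanley_ofE mxE /=.
  case: eqP => [->|_]; last by rewrite raddf0.
  by rewrite /stanley_keep keepX [mnm_in _ _]lm.
have uniq_mons i : uniq (mons i).
  by rewrite /mons; case: (e - _) => d //=; exact: monomials_uniq.
have val_sum (c : T -> K) j : val (\sum_(t <- l) (c t)%:MP *: b t) 0 j =
    \sum_(m <- mons j) c (j, m) *: 'X_[m].
  rewrite val_stanley_sum big_allpairs_dep /= (bigD1_seq j) ?enum_uniq ?mem_enum //=.
  rewrite [X in _ + X]big1 ?addr0 => [|i /negPf ij].
    rewrite big_seq [RHS]big_seq; apply: eq_bigr => m mj.
    rewrite val_stanley_scale valb // eqxx -mul_mpolyC; congr (_ * _).
    by rewrite /stanley_keep /keep comp_mpolyC.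
  rewrite big_seq big1 // => m mi.
  by rewrite val_stanley_scale valb // eq_sym ij mulr0.
have -> : (\sum_(x <- L) monomial_count (@low n x.1) (e - x.2%:Z))%N = size l.
  rewrite size_allpairs_dep sumnE big_map big_enum /= big_tnth.
  by apply: eq_bigr.
apply: (has_dim_seq (b := b)).
- by apply: allpairs_uniq_dep; rewrite ?enum_uniq // => -[i m] [j k] _ _ [-> ->].
- move=> [i m] /memP mi j; rewrite valb //; case: eqP => [->|_]; last exact: hpoly0.
  have /andP[_ /eqP <-] := lowP _ _ mi.
  by rewrite /= dhomogX /=.
- move=> v Hv; exists (fun t => (val v 0 t.1)@_t.2).
  apply/val_inj/rowP => j; rewrite val_sum.
  have := Hv j; rewrite /mons; case: (e - _) => d /= hv; last by rewrite big_nil.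
  apply: dhomog_support => // m; have := stanley_keep_val v j.
  by move=> /eqP/keep_idP; apply.
move=> c Hc [j m] /memP mj /=.
have := val_sum c j; rewrite Hc mxE => /(congr1 (mcoeff m)).
by rewrite mcoeff0 mcoeff_lincomb // mj.
Qed.

End StanleyTheory.

(** * Integer polynomials modulo a power of the variable *)

Section Truncation.
Variable B : nat.
Implicit Types p q r : {poly int}.

(** Equality of truncated power series.  It lets the identities between rational
    Hilbert series be checked on integer polynomials. *)
Definition eqmodX p q := exists r, p = q + r * 'X^B.

Lemma eqmodX_refl p : eqmodX p p.
Proof. by exists 0; rewrite mul0r addr0. Qed.

Lemma eqmodX_sym p q : eqmodX p q -> eqmodX q p.
Proof. by move=> [r ->]; exists (- r); rewrite mulNr addrK. Qed.

Lemma eqmodX_trans p q r : eqmodX p q -> eqmodX q r -> eqmodX p r.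
Proof. by move=> [s ->] [t ->]; exists (t + s); rewrite mulrDl addrA. Qed.

Lemma eqmodXD p1 q1 p2 q2 : eqmodX p1 q1 -> eqmodX p2 q2 -> eqmodX (p1 + p2) (q1 + q2).
Proof. by move=> [s ->] [t ->]; exists (s + t); rewrite mulrDl addrACA. Qed.

Lemma eqmodXM p1 q1 p2 q2 : eqmodX p1 q1 -> eqmodX p2 q2 -> eqmodX (p1 * p2) (q1 * q2).
Proof.
move=> [s ->] [t ->]; exists (q1 * t + s * (q2 + t * 'X^B)).
by rewrite mulrDl mulrDr mulrDl addrA !mulrA [s * 'X^B * _]mulrAC.
Qed.

Lemma eqmodX_exp k p q : eqmodX p q -> eqmodX (p ^+ k) (q ^+ k).
Proof.
move=> pq; elim: k => [|k IHk]; first exact: eqmodX_refl.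
by rewrite !exprS; exact: eqmodXM.
Qed.

Lemma eqmodX_sum (T : finType) (P : pred T) (F G : T -> {poly int}) :
  (forall i, P i -> eqmodX (F i) (G i)) ->
  eqmodX (\sum_(i | P i) F i) (\sum_(i | P i) G i).
Proof.
by move=> FG; apply: (big_ind2 eqmodX) => //; [exact: eqmodX_refl | exact: eqmodXD].
Qed.

Lemma eqmodX_coef p q i : eqmodX p q -> (i < B)%N -> p`_i = q`_i.
Proof. by move=> [r ->] iB; rewrite coefD coefMXn iB addr0. Qed.

Lemma geomE : (1 - 'X) * geom B = 1 - 'X^B.
Proof.
by apply: (can_inj opprK); rewrite -mulNr !opprB /geom -subrX1.
Qed.

Lemma geom_inv : eqmodX ((1 - 'X) * geom B) 1.
Proof. by exists (-1); rewrite geomE mulN1r. Qed.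

Lemma geom_sub1 : eqmodX (geom B - 1) ('X * geom B).
Proof.
have E : geom B = 'X * geom B + (1 - 'X^B) by rewrite -geomE mulrBl mul1r addrC subrK.
by exists (-1); rewrite mulN1r {1}E -addrA addrAC subrr add0r.
Qed.

Lemma geom_sub1_inv : eqmodX ((1 - 'X) * (geom B - 1)) 'X.
Proof.
apply: eqmodX_trans (eqmodXM (eqmodX_refl _) geom_sub1) _.
rewrite mulrCA -[X in eqmodX _ X]mulr1; exact: eqmodXM (eqmodX_refl _) geom_inv.
Qed.

End Truncation.

(** Taking differences is multiplication of the generating series by 1 - X. *)
Lemma iter_bdiff_coef B (h : int -> int) (p : {poly int}) r :
  (forall e, (e < B)%N -> h e = p`_e) -> (forall e, h (Negz e) = 0) ->
  (forall e, (e < B)%N -> iter r bdiff h e = ((1 - 'X) ^+ r * p)`_e) /\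
  (forall e, iter r bdiff h (Negz e) = 0).
Proof.
move=> hp h0; elim: r => [|r [IHr IHr0]].
  by split=> // e eB; rewrite expr0 mul1r; exact: hp.
split=> [e eB|e]; rewrite iterS /bdiff; last first.
  by rewrite IHr0 NegzE -opprD -PoszD addn1 -NegzE IHr0 subrr.
rewrite exprS -mulrA mulrBl mul1r coefB coefXM IHr //.
case: e eB => [|e] eB; first by rewrite sub0r -(NegzE 0) IHr0.
by rewrite -addn1 PoszD addrK addn1 IHr // ltnW.
Qed.

(** * The numerator polynomials of a family of subsets *)

Definition level n (F : {set {set 'I_n}}) j := [set A in F | #|A| == j].

Section Family.
Variables (n : nat) (F : {set {set 'I_n}}).

Definition family_count (e : int) : nat :=
  monomial_count (fun m => mnm_support m \in F) e.

(** Let H be the generating series of monomials with support in F, that is the sum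
    over A in F of (X/(1 - X))^|A|.  The terms with |A| <= d contribute this
    polynomial to (1 - X)^d H; those with |A| > d contribute nonnegative
    coefficients in degrees above d. *)
Definition family_poly (d : nat) : {poly int} :=
  \sum_(A in F | (#|A| <= d)%N) 'X^#|A| * (1 - 'X) ^+ (d - #|A|).

Lemma family_bdiff d k : (k <= d)%N ->
  iter d bdiff (fun e => (family_count e)%:Z) k = (family_poly d)`_k.
Proof.
move=> kd; set B := d.+1; have kB : (k < B)%N by [].
have [-> // _] := iter_bdiff_coef (B := B) d
  (h := fun e => (family_count e)%:Z) (p := \sum_(A in F) (geom B - 1) ^+ #|A|)
  (fun e eB => size_monomials_support F eB) (fun=> erefl).
rewrite mulr_sumr (bigID (fun A : {set 'I_n} => (#|A| <= d)%N)) /= coefD [X in _ + X](_ : _ = 0).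
  rewrite addr0; apply: eqmodX_coef kB; apply: eqmodX_sum => A /andP[_ Ad].
  rewrite -{1}(subnK Ad) exprD -mulrA -exprMn mulrC.
  by apply: eqmodXM (eqmodX_refl _ _); apply: eqmodX_exp; exact: geom_sub1_inv.
rewrite coef_sum big1 // => A /andP[_]; rewrite -ltnNge => dA.
have : eqmodX B ((geom B - 1) ^+ (#|A| - d) * ((1 - 'X) * (geom B - 1)) ^+ d)
    (('X * geom B) ^+ (#|A| - d) * 'X ^+ d).
  apply: eqmodXM; apply: eqmodX_exp; first exact: geom_sub1.
  exact: geom_sub1_inv.
rewrite !exprMn mulrCA -exprD subnK 1?ltnW // mulrAC -exprD subnK 1?ltnW //.
by move=> /eqmodX_coef ->//; rewrite coefXnM (leq_trans kB dA).
Qed.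

Lemma coef_1subX_exp m i : ((1 - 'X : {poly int}) ^+ m)`_i = (-1) ^+ i *+ 'C(m, i).
Proof.
elim: m i => [|m IHm] [|i]; rewrite ?expr0 ?coef1 ?bin0 ?bin0n ?mulr0n //.
  by rewrite exprS mulrBl mul1r coefB coefXM IHm subr0 bin0 expr0.
rewrite exprS mulrBl mul1r coefB coefXM !IHm /= binS mulrnDr; congr (_ + _).
by rewrite exprS mulN1r mulNrn.
Qed.

Lemma size_family_poly d : (size (family_poly d) <= d.+1)%N.
Proof.
apply: leq_trans (size_sum _ _ _) _; apply/bigmax_leqP => A /andP[_ Ad].
apply: leq_trans (size_polyMleq _ _) _; rewrite size_polyXn addSn /=.
have: (size ((1 - 'X : {poly int}) ^+ (d - #|A|)) <= (d - #|A|).+1)%N.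
  have -> : 1 - 'X = - ('X - 1%:P) :> {poly int} by rewrite opprB.
  by rewrite exprNn -signr_odd; case: odd;
     rewrite ?expr0 ?expr1 ?mul1r ?mulN1r ?size_polyN size_exp_XsubC.
by move/(leq_add (leqnn #|A|)) => /leq_trans; apply; rewrite addnS subnKC.
Qed.

Lemma horner_family_poly d : (family_poly d).[1] = #|level F d|%:Z.
Proof.
rewrite /family_poly horner_sum -sum1_card -natz natr_sum big_mkcond [RHS]big_mkcond /=.
apply: eq_bigr => A _; rewrite inE; case: (A \in F) => //=.
rewrite leq_eqVlt; have [->|neq] := eqVneq #|A| d.
  by rewrite subnn expr0 mulr1 hornerXn expr1n.
case: ltnP => //= Ad; rewrite hornerM !horner_exp hornerD hornerN hornerX hornerC.
by rewrite subrr expr0n subn_eq0 leqNgt Ad mulr0.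
Qed.

(** The value at 1 is the sum of the coefficients. *)
Lemma family_poly_eq0 d : (forall k, (k <= d)%N -> 0 <= (family_poly d)`_k) ->
  (family_poly d).[1] = 0 -> family_poly d = 0.
Proof.
move=> ge0; rewrite (horner_coef_wide _ (size_family_poly d)).
under eq_bigr do rewrite expr1n mulr1.
move=> /eqP; rewrite psumr_eq0 => [/allP Hall|i _]; last by apply: ge0; rewrite -ltnS.
apply/polyP => k; rewrite coef0; have [kd|dk] := ltnP k d.+1; last first.
  by rewrite nth_default // (leq_trans (size_family_poly d)).
by have /eqP := Hall (Ordinal kd) (mem_index_enum _).
Qed.

Lemma family_poly_shift d : (n <= d)%N -> family_poly d = (1 - 'X) ^+ (d - n) * family_poly n.
Proof.
move=> nd; have cn (A : {set 'I_n}) : (#|A| <= n)%N by rewrite -[leqRHS]card_ord max_card.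
rewrite /family_poly mulr_sumr; apply: eq_big => [A|A _].
  by rewrite (leq_trans (cn A) nd) cn.
by rewrite mulrCA -exprD addnBA ?cn // subnK.
Qed.

Hypothesis FT : [set: 'I_n] \in F.

Lemma family_poly_neq0 d : (n <= d)%N -> family_poly d != 0.
Proof.
move=> nd; rewrite family_poly_shift // mulf_neq0 //.
  apply: expf_neq0; apply/eqP => /(congr1 (fun p : {poly int} => p`_0)).
  by rewrite coefB coef1 coefX coef0.
apply/eqP => /(congr1 (horner^~ 1)); rewrite horner_family_poly horner0 => /eqP.
rewrite eqz_nat cards_eq0 => /eqP/setP/(_ [set: 'I_n]).
by rewrite inE FT cardsT card_ord eqxx inE.
Qed.

End Family.

(** * Realizing a nonnegative numerator by a direct sum *)

Lemma low_count_coef n B r k e : (r <= n)%N -> (e < B)%N ->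
  (monomial_count (@low n r) (e%:Z - k%:Z))%:Z = ('X^k * geom B ^+ r)`_e.
Proof.
move=> rn eB; rewrite coefXnM; case: ltnP => [ek|ke].
  have -> : e%:Z - k%:Z = Negz (k - e).-1 by lia.
  by [].
by rewrite subzn //=; apply: size_monomials_low => //; exact: leq_ltn_trans (leq_subr _ _) eB.
Qed.

Section StanleyList.
Variables (n : nat) (F : {set {set 'I_n}}) (d : nat).

(** Up to degree d the coefficients of the numerator prescribe the number of copies of
    K[x_0, ..., x_(d-1)] in each degree; a set A with more than d elements
    contributes K[x_0, ..., x_(|A|-1)](-|A|), with series (X/(1 - X))^|A|. *)
Definition stanley_list : seq (nat * nat) :=
  flatten [seq nseq `|((family_poly F d)`_k)%R|%N (d, k) | k <- iota 0 d.+1]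
  ++ [seq (#|(A : {set 'I_n})|, #|A|) | A <- enum [pred A in F | (d < #|A|)%N]].

Hypothesis dn : (d <= n)%N.

Lemma stanley_list_dim x : x \in stanley_list -> (d <= x.1)%N.
Proof.
rewrite mem_cat => /orP[/flatten_mapP[k _ /nseqP[-> _]] //|/mapP[A]].
by rewrite mem_enum => /andP[_ dA] ->; exact: ltnW.
Qed.

Lemma stanley_list_dim_leq x : x \in stanley_list -> (x.1 <= n)%N.
Proof.
rewrite mem_cat => /orP[/flatten_mapP[k _ /nseqP[-> _]] //|/mapP[A _ ->]].
by rewrite -[leqRHS]card_ord max_card.
Qed.

Hypothesis Fge0 : forall k, (k <= d)%N -> 0 <= (family_poly F d)`_k.

Lemma stanley_list_poly (p : {poly int}) : \sum_(x <- stanley_list) 'X^(x.2) * p ^+ (x.1) =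
  family_poly F d * p ^+ d + \sum_(A in F | ~~ (#|A| <= d)%N) 'X^#|A| * p ^+ #|A|.
Proof.
rewrite big_cat big_flatten !big_map big_enum; congr (_ + _); last first.
  by apply: eq_bigl => A; rewrite inE ltnNge.
rewrite -[iota 0 d.+1]/(index_iota 0 d.+1) big_mkord.
have {2}-> : family_poly F d = \sum_(k < d.+1) (family_poly F d)`_k *: 'X^k.
  rewrite -poly_def; apply/polyP => k; rewrite coef_poly; case: ltnP => // dk.
  by rewrite nth_default // (leq_trans (size_family_poly F d)).
rewrite mulr_suml; apply: eq_bigr => k _; rewrite big_nseq iter_addr_0 /=.
by rewrite -scalerAl -scaler_nat natz gez0_abs // Fge0 // -ltnS.
Qed.

(** As 1 - X inverts the truncated geometric series G and G - 1 is X G up to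
    truncation, X^a (1 - X)^(d - a) G^d is (G - 1)^a for every a <= d. *)
Lemma stanley_list_count e :
  (\sum_(x <- stanley_list) monomial_count (@low n x.1) (e - x.2%:Z))%N
  = family_count F e.
Proof.
case: e => e; last first.
  rewrite big1_seq // => -[r k] _ /=.
  by have -> : Negz e - k%:Z = Negz (e + k) by lia.
apply: (@can_inj _ _ Posz absz) => //; set B := e.+1.
have eB : (e < B)%N by [].
rewrite [RHS](size_monomials_support F eB) -natz natr_sum.
transitivity ((\sum_(x <- stanley_list) 'X^(x.2) * geom B ^+ (x.1))`_e).
  rewrite coef_sum !big_seq; apply: eq_bigr => x Lx.
  by rewrite natz (low_count_coef _ (stanley_list_dim_leq Lx) eB).
rewrite stanley_list_poly [in RHS](bigID (fun A : {set 'I_n} => (#|A| <= d)%N)) /=.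
apply: eqmodX_coef eB; apply: eqmodX_sym; apply: eqmodXD; last first.
  by apply: eqmodX_sum => A _; rewrite -exprMn; apply: eqmodX_exp; exact: geom_sub1.
rewrite mulr_suml; apply: eqmodX_sum => A /andP[_ Ad].
have -> : 'X^#|A| * (1 - 'X) ^+ (d - #|A|) * geom B ^+ d =
    ((1 - 'X) * geom B) ^+ (d - #|A|) * ('X * geom B) ^+ #|A|.
  by rewrite !exprMn mulrACA -exprD subnK // [X in _ = X * _]mulrC.
rewrite -[X in eqmodX _ X _]mul1r; apply: eqmodXM; last first.
  by apply: eqmodX_exp; exact: geom_sub1.
apply: eqmodX_sym; rewrite -[X in eqmodX _ _ X](expr1n _ (d - #|A|)).
by apply: eqmodX_exp; exact: geom_inv.
Qed.

End StanleyList.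

(** * Shadows in an up-closed family *)

Section Shadow.
Variables (n : nat) (F : {set {set 'I_n}}).
Hypothesis F_up : forall A B : {set 'I_n}, A \subset B -> A \in F -> B \in F.
Implicit Types (A B : {set 'I_n}) (j : nat).

Definition upper_shadow A := [set x |: A | x in ~: A].

Lemma card_upper_shadow A : #|upper_shadow A| = (n - #|A|)%N.
Proof.
rewrite card_in_imset; first by rewrite cardsCs setCK card_ord.
move=> x y; rewrite !inE => xA yA /setP/(_ x).
by rewrite !inE eqxx (negPf xA) !orbF => /esym/eqP.
Qed.

Lemma upper_shadowP A B : (B \in upper_shadow A) = (A \subset B) && (#|B| == #|A|.+1).
Proof.
apply/imsetP/andP => [[x xA ->]|[AB cB]].
  by rewrite subsetUr cardsU1; move: xA; rewrite inE => ->.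
have /cards1P[x xE] : #|B :\: A| == 1%N.
  by rewrite cardsD (setIidPr AB) (eqP cB) subSnn.
have : x \in B :\: A by rewrite xE inE.
rewrite inE => /andP[xA xB]; exists x; first by rewrite inE.
by rewrite -xE setUC -(setID B A) (setIidPr AB) setDUl setDv set0U setDDl setUid.
Qed.

Lemma upper_shadow_level j A : A \in level F j -> upper_shadow A \subset level F j.+1.
Proof.
rewrite inE => /andP[AF /eqP Aj]; apply/subsetP => B.
by rewrite upper_shadowP Aj inE => /andP[/F_up -> // ->].
Qed.

(** Double counting of the pairs A in B with |A| = j, |B| = j + 1 and A in F. *)
Lemma card_level_LYM j : ((n - j) * #|level F j| <= j.+1 * #|level F j.+1|)%N.
Proof.
have -> : ((n - j) * #|level F j| = \sum_(A in level F j) \sum_(B in level F j.+1) (A \subset B))%N.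
  rewrite mulnC -sum_nat_const; apply: eq_bigr => A Aj.
  have cA : #|A| = j by move: Aj; rewrite inE => /andP[_ /eqP].
  rewrite -cA -card_upper_shadow -sum1_card big_mkcond [RHS]big_mkcond /=.
  apply: eq_bigr => B _; rewrite upper_shadowP inE cA.
  have [AB|] := boolP (A \subset B) => /=; last by case: ifP.
  by rewrite (F_up AB) //; move: Aj; rewrite inE => /andP[].
rewrite exchange_big /= mulnC -sum_nat_const; apply: leq_sum => B.
rewrite inE => /andP[_ /eqP cB].
have -> : j.+1 = #|[set A : {set 'I_n} | (A \subset B) & (#|A| == j)]|.
  by rewrite cards_draws cB binSn.
rewrite -sum1_card big_mkcond [leqRHS]big_mkcond /=; apply: leq_sum => A _.
by rewrite !inE; case: (A \in F) => //=; case: (#|A| == j); rewrite ?andbF //; case: (A \subset B).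
Qed.

(** Two distinct sets of size j have at most one common superset of size j + 1, namely
    their union; so the t-th of m sets of the level adds at least n - j - (t - 1) sets to
    the shadow. *)
Lemma card_level_bonferroni j m : (m <= #|level F j|)%N ->
  (m * (n - j) <= #|level F j.+1| + 'C(m, 2))%N.
Proof.
move=> mj; pose s := take m (enum (level F j)).
have sz : size s = m by rewrite size_takel // -cardE.
have us : uniq s by rewrite take_uniq // enum_uniq.
have sj A : A \in s -> A \in level F j by move=> /mem_take; rewrite mem_enum.
rewrite -sz => {mj}; clearbody s; move: sz => _.
suff: (size s * (n - j) <= #|\bigcup_(A <- s) upper_shadow A| + 'C(size s, 2))%N.
  move=> /leq_trans; apply; rewrite leq_add2r; apply: subset_leq_card.
  rewrite big_seq.
  apply: (big_ind (fun X : {set {set 'I_n}} => X \subset level F j.+1)) => [|X Y|A As].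
    exact: sub0set.
    by move=> *; rewrite subUset; apply/andP.
  by apply: upper_shadow_level; exact: sj.
elim: s us sj => [|A s IHs] /=; first by rewrite mul0n.
move=> /andP[As us] sj; rewrite big_cons cardsU card_upper_shadow.
have cl A' : A' \in A :: s -> #|A'| = j by move=> /sj; rewrite inE => /andP[_ /eqP].
rewrite cl ?mem_head // binS bin1 mulSn.
have sj' A' : A' \in s -> A' \in level F j by move=> A's; apply: sj; rewrite inE A's orbT.
have := IHs us sj'.
have : (#|upper_shadow A :&: \bigcup_(A0 <- s) upper_shadow A0| <= size s)%N.
  apply: leq_trans (_ : #|[set A :|: A' | A' in s]| <= _)%N; last first.
    exact: leq_trans (leq_imset_card _ _) (card_size s).
  apply: subset_leq_card; apply/subsetP => B; rewrite inE bigcup_seq.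
  move=> /andP[BA /bigcupP[A' A's BA']].
  apply/imsetP; exists A' => //; apply/esym/eqP; rewrite eqEcard.
  have cA : #|A| = j by rewrite cl ?mem_head.
  have cA' : #|A'| = j by rewrite cl // inE A's orbT.
  move: BA BA'; rewrite !upper_shadowP cA cA' => /andP[AB /eqP ->] /andP[A'B _].
  rewrite subUset AB A'B /= ltnNge; apply/negP => le.
  have AU : A == A :|: A' by rewrite eqEcard subsetUl cA.
  have A'U : A' == A :|: A' by rewrite eqEcard subsetUr cA'.
  by move: As; rewrite (eqP AU) -(eqP A'U) A's.
have : (#|upper_shadow A :&: \bigcup_(A0 <- s) upper_shadow A0| <=
        #|\bigcup_(A0 <- s) upper_shadow A0|)%N by apply: subset_leq_card; exact: subsetIr.
have arith (k a b c b2 z : nat) :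
  (a <= b -> a <= z -> c <= b + b2 -> k + c <= k + b - a + (b2 + z))%N by lia.
exact: arith.
Qed.

End Shadow.

(** * The inequalities in six variables *)

(** The coefficient of X^k in X^j (1 - X)^(d - j), for j <= k. *)
Definition beta_coef (d k j : nat) : int := (-1) ^+ (k - j) *+ 'C(d - j, k - j).

Lemma coef_family_poly n (F : {set {set 'I_n}}) d k : (k <= d)%N ->
  (family_poly F d)`_k = \sum_(j < k.+1) beta_coef d k j * #|level F j|%:Z.
Proof.
move=> kd; rewrite /family_poly coef_sum.
under eq_bigr do rewrite coefXnM coef_1subX_exp.
rewrite (bigID (fun A : {set 'I_n} => (#|A| <= k)%N)) /= [X in _ + X]big1 ?addr0; last first.
  by move=> A /andP[_]; rewrite -ltnNge => ->.
rewrite (partition_big (fun A : {set 'I_n} => inord #|A| : 'I_k.+1) predT) //=.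
apply: eq_bigr => j _; rewrite mulrC -natz mulr_natl -sumr_const.
apply: eq_big => [A|A].
  rewrite inE -!andbA; case: (A \in F) => //=.
  apply/idP/eqP => [/and3P[_ Ak /eqP <-]|->]; first by rewrite inordK.
  have jk : (j <= k)%N by rewrite -ltnS.
  by rewrite jk (leq_trans jk kd) inord_val eqxx.
move=> /andP[/andP[_ Ak] /eqP jE]; rewrite ltnNge Ak /=.
by rewrite -jE inordK.
Qed.

Lemma card_level_setC n (F : {set {set 'I_n}}) j :
  (#|level (~: F) j| + #|level F j|)%N = 'C(n, j).
Proof.
have <- : #|[set A : {set 'I_n} | #|A| == j]| = 'C(n, j) by rewrite card_draws card_ord.
rewrite -cardsUI.
have -> : level (~: F) j :&: level F j = set0.
  by apply/setP => A; rewrite !inE; case: (A \in F); rewrite ?andbF.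
by rewrite cards0 addn0; apply: eq_card => A; rewrite !inE; case: (A \in F) => /=; rewrite ?orbF.
Qed.

Ltac eval_beta_coef :=
  repeat match goal with
  | H : context [beta_coef ?d ?k ?j] |- _ =>
      let v := eval vm_compute in (beta_coef d k j) in change (beta_coef d k j) with v in H
  | |- context [beta_coef ?d ?k ?j] =>
      let v := eval vm_compute in (beta_coef d k j) in change (beta_coef d k j) with v
  end.

(** Writing f_j for the number of faces and g_j for the number of nonfaces with j
    elements, the sum of the two numerators is (1 - X)^(d - 6) up to degree d.  Thus
    both the hypothesis on f and the two shadow inequalities are linear constraints
    on the g_j.  The second shadow inequality is needed only for one or three sets of
    size 2 and for one or two sets of size 3; for each d and k the constraints have
    no integral solution with a negative coefficient for g. *)
Lemma complement_coef_ge0 (f g : nat -> nat) (d k : nat) :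
  (forall j, (f j + g j)%N = 'C(6, j)) -> g 0%N = 0%N -> g 6 = 1%N ->
  (forall j, ((6 - j) * g j <= j.+1 * g j.+1)%N) ->
  (forall j m, (m <= g j)%N -> (m * (6 - j) <= g j.+1 + 'C(m, 2))%N) ->
  (d < 6)%N ->
  (forall k, (k <= d)%N -> 0 <= \sum_(j < k.+1) beta_coef d k j * (f j)%:Z) ->
  (k <= d)%N -> 0 <= \sum_(j < k.+1) beta_coef d k j * (g j)%:Z.
Proof.
move=> fg g0 g6 lym bon d6 Hf kd.
have f0 : (f 0 + g 0 = 1)%N := fg 0%N.
have f1 : (f 1 + g 1 = 6)%N := fg 1%N.
have f2 : (f 2 + g 2 = 15)%N := fg 2%N.
have f3 : (f 3 + g 3 = 20)%N := fg 3%N.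
have f4 : (f 4 + g 4 = 15)%N := fg 4%N.
have f5 : (f 5 + g 5 = 6)%N := fg 5%N.
have l1 : (5 * g 1 <= 2 * g 2)%N := lym 1%N.
have l2 : (4 * g 2 <= 3 * g 3)%N := lym 2%N.
have l3 : (3 * g 3 <= 4 * g 4)%N := lym 3%N.
have l4 : (2 * g 4 <= 5 * g 5)%N := lym 4%N.
have b21 : (0 < g 2 -> 4 <= g 3 + 0)%N := bon 2%N 1%N.
have b23 : (2 < g 2 -> 12 <= g 3 + 3)%N := bon 2%N 3%N.
have b31 : (0 < g 3 -> 3 <= g 4 + 0)%N := bon 3%N 1%N.
have b32 : (1 < g 3 -> 6 <= g 4 + 1)%N := bon 3%N 2%N.
clear fg lym bon.
have [H1 H2 H3 H4 H5] : [/\ (0 < d)%N -> 0 <= \sum_(j < 2) beta_coef d 1 j * (f j)%:Z,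
  (1 < d)%N -> 0 <= \sum_(j < 3) beta_coef d 2 j * (f j)%:Z,
  (2 < d)%N -> 0 <= \sum_(j < 4) beta_coef d 3 j * (f j)%:Z,
  (3 < d)%N -> 0 <= \sum_(j < 5) beta_coef d 4 j * (f j)%:Z &
  (4 < d)%N -> 0 <= \sum_(j < 6) beta_coef d 5 j * (f j)%:Z].
  by split=> Hd; exact: Hf.
clear Hf; rewrite !big_ord_recr !big_ord0 /= in H1 H2 H3 H4 H5.
move: kd H1 H2 H3 H4 H5; move: d6.
do 6?[case: d => [|d]] => //= _.
all: do 6?[case: k => [|k]] => //= _.
all: rewrite ?big_ord_recr ?big_ord0 /=.
all: move=> H1 H2 H3 H4 H5.
(* Only the hypotheses H_k with k <= d have a true premise. *)
all: try move: (H1 isT); try move: (H2 isT); try move: (H3 isT).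
all: try move: (H4 isT); try move: (H5 isT).
all: clear H1 H2 H3 H4 H5; eval_beta_coef.
all: lia.
Qed.

(** * Hilbert depth *)

Lemma max_nat_mem (A : nat -> Prop) : (0 < max_nat A)%N -> A (max_nat A).
Proof. by rewrite /max_nat; case: classical_sets.xgetP => // d _ [Ad _]. Qed.

(** A bounded nonempty set has a maximum, so the default value does not occur. *)
Lemma max_nat_ge (A : nat -> Prop) b d : (forall k, A k -> (k <= b)%N) -> A d ->
  (d <= max_nat A)%N.
Proof.
move=> Ab Ad; have ex : exists k, `[< A k >] by exists d; apply/asboolP.
have ub k : `[< A k >] -> (k <= b)%N by move=> /asboolP; exact: Ab.
rewrite /max_nat; case: classical_sets.xgetP => [m _ [_]|no]; first exact.
case: (ex_maxnP ex ub) => m /asboolP Am mmax; case: (no m); split=> // k Ak.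
by apply: mmax; apply/asboolP.
Qed.

Section HilbertDepth.
Variables (K : fieldType) (n : nat) (I : idealr {mpoly K[n]}).
Hypothesis Isf : squarefree_monomial_ideal I.
Local Notation F := (squarefree_supports I).
Local Notation SI := (quotient_gmod (squarefree_monomial_homogeneous Isf)).
Local Notation II := (ideal_gmod (squarefree_monomial_homogeneous Isf)).

(** Only the coefficients in degrees k <= d of (1 - X)^d H are given by the numerator
    polynomial; the others are nonnegative anyway. *)
Lemma regular_family_poly_ge0 (M N : graded_module K n) (G : {set {set 'I_n}}) s :
  (forall e, has_dim (hcomp M e) (family_count G e)) ->
  same_hilbert_series M N -> finitely_generated N -> regular_sequence N s ->
  forall k, (k <= size s)%N -> 0 <= (family_poly G (size s))`_k.
Proof.
move=> HM MN Nfg reg k ks; rewrite -family_bdiff //.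
apply: (regular_sequence_bdiff_ge0 (N := N) (h := family_count G)) => // e.
have [j [Mj Nj]] := MN e.
by rewrite (has_dim_inj (grad0 (hcomp_grading M) e) (HM e) Mj).
Qed.

Lemma depth_regular (N : graded_module K n) : (0 < depth N)%N ->
  exists2 s, size s = depth N & regular_sequence N s.
Proof. by move=> /max_nat_mem[s [ss reg]]; exists s. Qed.

Lemma hdepth_quotient_ge0 (d := hdepth SI) : (0 < d)%N ->
  forall k, (k <= d)%N -> 0 <= (family_poly (~: F) d)`_k.
Proof.
move=> d0; have [N [Nfg SN dN]] := max_nat_mem d0.
have [|s ss reg] := depth_regular (N := N); first by rewrite dN.
move=> k kd; have := regular_family_poly_ge0 (quotient_has_dim Isf) SN Nfg reg.
by rewrite ss dN; apply.
Qed.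

Hypothesis I_neq0 : exists2 p, p \in I & p != 0.

(** For d >= n the coefficients of the numerator add up to the number of faces with d
    elements, which is zero as the full set is a nonface; but the constant
    coefficient, coming from the empty face, is 1. *)
Lemma family_poly_ge0_lt d : (forall k, (k <= d)%N -> 0 <= (family_poly (~: F) d)`_k) ->
  (d < n)%N.
Proof.
move=> ge0; rewrite ltnNge; apply/negP => nd.
have [] : (family_poly (~: F) d)`_0 <> 0.
  rewrite coef_family_poly // big_ord1 /beta_coef subnn bin0 expr0 mul1r.
  move/eqP; rewrite eqz_nat cards_eq0 => /eqP/setP/(_ set0).
  by rewrite inE in_setC squarefree_supports0 // cards0 inE.
rewrite (family_poly_eq0 ge0) ?coef0 // horner_family_poly.
apply/eqP; rewrite eqz_nat cards_eq0; apply/eqP/setP => A; rewrite in_set0 inE.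
apply/negbTE; rewrite inE negb_and negbK -implyNb; apply/implyP => AF.
apply: contra AF => /eqP Ad.
rewrite (_ : A = [set: _]); first exact: squarefree_supportsT.
by apply/eqP; rewrite eqEcard subsetT cardsT card_ord Ad.
Qed.

(** For r > n the coefficients of the numerator add up to zero, so it vanishes if they
    are nonnegative.  It does not vanish: divided by (1 - X)^(r - n) it takes the value
    1 at 1, as the full set belongs to the family. *)
Lemma ideal_regular_leq (N : graded_module K n) s : same_hilbert_series II N ->
  finitely_generated N -> regular_sequence N s -> (size s <= n)%N.
Proof.
move=> IN Nfg reg; rewrite leqNgt; apply/negP => ns.
have ge0 := regular_family_poly_ge0 (ideal_has_dim Isf) IN Nfg reg.
have /eqP[] := family_poly_neq0 (squarefree_supportsT Isf I_neq0) (ltnW ns).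
apply: family_poly_eq0 ge0 _; rewrite horner_family_poly.
apply/eqP; rewrite eqz_nat cards_eq0; apply/eqP/setP => A; rewrite in_set0 inE.
apply/negbTE; rewrite negb_and neq_ltn (leq_ltn_trans _ ns) ?orbT //.
by rewrite -[leqRHS]card_ord max_card.
Qed.

Lemma depth_leq_ideal (N : graded_module K n) : same_hilbert_series II N ->
  finitely_generated N -> (depth N <= n)%N.
Proof.
move=> IN Nfg; case: (posnP (depth N)) => [->//|/depth_regular[s <- reg]].
exact: ideal_regular_leq reg.
Qed.

(** The direct sum prescribed by the numerator has the Hilbert series of I, and the
    first d variables form a regular sequence on it. *)
Lemma leq_hdepth_ideal d : (d <= n)%N ->
  (forall k, (k <= d)%N -> 0 <= (family_poly F d)`_k) -> (d <= hdepth II)%N.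
Proof.
move=> dn ge0; pose L := stanley_list F d; pose N := stanley_gmod K n L.
have IN : same_hilbert_series II N.
  move=> e; exists (family_count F e); split; first exact: ideal_has_dim.
  by rewrite -(stanley_list_count dn ge0); exact: stanley_has_dim.
have Nfg : finitely_generated N by exact: stanley_finitely_generated.
have L0 : (0 < size L)%N.
  case E : L => [|x L'] //.
  have : family_count F n = 0%N.
    by rewrite -(stanley_list_count dn ge0) -/L E big_nil.
  rewrite /family_count /= => /eqP/nilP/(congr1 (fun l => mnm_of_set [set: 'I_n] \in l)).
  rewrite mem_monomials in_nil -mpolyX_mem //.
  have := squarefree_supportsT Isf I_neq0; rewrite inE => ->; rewrite andbT.
  by rewrite mdegE (eq_bigr (fun=> 1%N)) ?sum1_card ?card_ord ?eqxx // => i _; rewrite mnmE inE.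
have reg : regular_sequence N (take d (variables K n)).
  apply: stanley_regular => // l; apply: stanley_list_dim; exact: mem_tnth.
apply: (@leq_trans (depth N)).
  apply: (max_nat_ge (b := n)) => [k [s [<- regs]]|].
    exact: ideal_regular_leq regs.
  by exists (take d (variables K n)); rewrite size_variables.
apply: (max_nat_ge (b := n)) => [k [N' [N'fg IN' <-]]|]; first exact: depth_leq_ideal.
by exists N.
Qed.

End HilbertDepth.

Theorem corollary3p15 (K : fieldType) (I : idealr {mpoly K[6]})
    (I_neq0 : exists2 p, p \in I & p != 0)
    (I_sqfree : squarefree_monomial_ideal I) :
  (hdepth (quotient_gmod (squarefree_monomial_homogeneous I_sqfree))
   <= hdepth (ideal_gmod (squarefree_monomial_homogeneous I_sqfree)))%N.
Proof.
case: (posnP (hdepth (quotient_gmod (squarefree_monomial_homogeneous I_sqfree)))) => [->//|].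
move=> /hdepth_quotient_ge0; set d := hdepth _ => ge0.
have d6 := family_poly_ge0_lt I_sqfree I_neq0 ge0.
apply: leq_hdepth_ideal => //; first exact: ltnW.
move=> k kd; rewrite coef_family_poly //.
have F_up := @squarefree_supports_up K 6 I.
set F := squarefree_supports I in ge0 F_up *.
apply: (complement_coef_ge0 (f := fun j => #|level (~: F) j|) (g := fun j => #|level F j|)) => //.
- by move=> j; exact: card_level_setC.
- apply/eqP; rewrite cards_eq0; apply/eqP/setP => A; rewrite in_set0 inE cards_eq0.
  apply/negbTE; rewrite negb_and orbC -implybE; apply/implyP => /eqP ->.
  exact: squarefree_supports0.
- rewrite (_ : level F 6 = set1 [set: 'I_6]) ?cards1 //; apply/setP => A.
  rewrite inE in_set1; apply/andP/eqP => [[_ /eqP cA]|->].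
    by apply/eqP; rewrite eqEcard subsetT cardsT card_ord cA.
  by rewrite cardsT card_ord; split=> //; exact: squarefree_supportsT.
- exact: card_level_LYM F_up.
- exact: card_level_bonferroni F_up.
- by move=> k' kd'; rewrite -coef_family_poly //; exact: ge0.
Qed.
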